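(* Let $\mathbb{H}=\{(u_1,u_2)\in\mathbb{R}^2: u_2<0\}$, equipped with the Hessian metric with potential $$\Psi(u)=-\frac{u_1^2}{4u_2}-\frac12\log(-2u_2).$$ Then the associated Kähler surface $(T\mathbb{H},g^D,J)$ (the Sasaki metric on the tangent bundle) is complete and has non-negative orthogonal anti-bisectional curvature (NOAB), but it is neither a Hermitian symmetric space nor biholomorphic to $\mathbb{C}^2$.
   Context: Sasaki metric: let $g_{ij}=\Psi_{ij}=\partial_{u_i}\partial_{u_j}\Psi$ on $\mathbb{H}$, and let $D$ be the flat connection given by differentiation in the $u$-coordinates. On $T\mathbb{H}$ use coordinates $(u_i,v_i)$, where $(u,v)$ denotes the tangent vector $\sum_i v_i\partial_{u_i}$ at $u$. The Sasaki metric is the Kähler structure with complex structure $J\partial_{u_i}=\partial_{v_i}$, $J\partial_{v_i}=-\partial_{u_i}$ and Riemannian metric $g^D(\partial_{u_i},\partial_{u_j})=g^D(\partial_{v_i},\partial_{v_j})=\Psi_{ij}(u)$, $g^D(\partial_{u_i},\partial_{v_j})=0$. Let $R_{g^D}$ be its curvature tensor, with the sign convention that $R(A,B,A,B)$ equals the sectional curvature of the plane spanned by $A,B$ times $|A|^2|B|^2-\langle A,B\rangle^2$. A tangent vector $\xi=\sum_i\xi^i\partial_{u_i}$ on $\mathbb{H}$ is extended to $T\mathbb{H}$ as the vector with the same expression $\sum_i\xi^i\partial_{u_i}$ in the coordinates $(u,v)$. For such real vectors $\xi,\eta$ the anti-bisectional curvature is $$\mathfrak{A}(\eta,\xi)=R_{g^D}(\xi,J\eta,\xi,J\eta)-R_{g^D}(\eta,\xi,\eta,\xi).$$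 Its restriction to orthogonal pairs $\xi\perp\eta$ is the orthogonal anti-bisectional curvature, and the metric has (NOAB) if this is non-negative for all orthogonal real $\xi,\eta$. *)

(* Defs.v *)
(* MathComp-Analysis, over an arbitrary [R : realType]. *)
From HB Require Import structures.
From mathcomp Require Import all_boot all_order all_algebra.
From mathcomp Require Import all_classical all_reals all_analysis.
Set Implicit Arguments.
Unset Strict Implicit.
Unset Printing Implicit Defensive.
Import Order.TTheory GRing.Theory Num.Theory.
Import numFieldNormedType.Exports.
Local Open Scope classical_set_scope.
Local Open Scope ring_scope.

(** * Calculus on open subsets of R^n

    Points and tangent vectors are row vectors.  Functions are total; only
    their values on the open set under consideration matter. *)

Definition partial (R : realType) (n : nat) (i : 'I_n)
    (f : 'rV[R]_n -> R) (p : 'rV[R]_n) : R :=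
  'D_(delta_mx 0 i) f p.

Fixpoint Ck (R : realType) (n : nat) (k : nat) (U : set 'rV[R]_n)
    (f : 'rV[R]_n -> R) : Prop :=
  match k with
  | 0%N => forall p, U p -> {for p, continuous f}
  | k'.+1 => (forall p, U p -> differentiable f p) /\
             (forall i, Ck k' U (partial i f))
  end.

Definition smooth (R : realType) (n m : nat) (U : set 'rV[R]_n)
    (F : 'rV[R]_n -> 'rV[R]_m) : Prop :=
  forall (k : nat) (j : 'I_m), Ck k U (fun p => F p 0 j).

(** * Riemannian metrics in global coordinates

    A metric on an open set of R^n is given by its Gram matrices
    [g p i j = g_p (d_i, d_j)]. *)

Definition pairing (R : realType) (n : nat) (A : 'M[R]_n) (x y : 'rV[R]_n) : R :=
  (x *m A *m y^T) 0 0.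

(* Christoffel symbol Gamma^k_ij of the Levi-Civita connection. *)
Definition christoffel (R : realType) (n : nat) (g : 'rV[R]_n -> 'M[R]_n)
    (k i j : 'I_n) (p : 'rV[R]_n) : R :=
  2^-1 * \sum_l invmx (g p) k l *
    (partial i (fun q => g q j l) p + partial j (fun q => g q i l) p
     - partial l (fun q => g q i j) p).

(* The coefficient of d_m in R(d_i, d_j) d_l, where
   R(X,Y)Z = D_X D_Y Z - D_Y D_X Z - D_[X,Y] Z. *)
Definition curvature_up (R : realType) (n : nat) (g : 'rV[R]_n -> 'M[R]_n)
    (m i j l : 'I_n) (p : 'rV[R]_n) : R :=
  partial i (christoffel g m j l) p - partial j (christoffel g m i l) p
  + \sum_r (christoffel g m i r p * christoffel g r j l p
            - christoffel g m j r p * christoffel g r i l p).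

(* R(A,B,C,D) = < R(A,B)D, C >, so that R(A,B,A,B) is the sectional curvature
   of span(A,B) times |A|^2 |B|^2 - <A,B>^2. *)
Definition Riem (R : realType) (n : nat) (g : 'rV[R]_n -> 'M[R]_n)
    (p : 'rV[R]_n) (A B C D : 'rV[R]_n) : R :=
  \sum_i \sum_j \sum_k \sum_l A 0 i * B 0 j * C 0 k * D 0 l *
    (\sum_m g p k m * curvature_up g m i j l p).

Definition C1_curve (R : realType) (n : nat) (c : R -> 'rV[R]_n) : Prop :=
  (forall t, derivable c t 1) /\ continuous (derive1 c).

Definition curve_length (R : realType) (n : nat) (g : 'rV[R]_n -> 'M[R]_n)
    (c : R -> 'rV[R]_n) : \bar R :=
  (\int[lebesgue_measure]_(t in `[0%R, 1%R])
     (Num.sqrt (pairing (g (c t)) (derive1 c t) (derive1 c t)))%:E)%E.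

(* [pw_curve M g p q L]: there is a piecewise C^1 curve of length L in M from
   p to q.  Each C^1 piece is reparametrized to [0, 1] and extended to a C^1
   curve on R; only its restriction to [0, 1] has to stay in M. *)
Inductive pw_curve (R : realType) (n : nat) (M : set 'rV[R]_n)
    (g : 'rV[R]_n -> 'M[R]_n) : 'rV[R]_n -> 'rV[R]_n -> \bar R -> Prop :=
| pw_nil p : M p -> pw_curve M g p p 0%E
| pw_cons c q L :
    C1_curve c -> (forall t, 0 <= t <= 1 -> M (c t)) ->
    pw_curve M g (c 1) q L ->
    pw_curve M g (c 0) q (curve_length g c + L)%E.

Definition riem_dist (R : realType) (n : nat) (M : set 'rV[R]_n)
    (g : 'rV[R]_n -> 'M[R]_n) (p q : 'rV[R]_n) : \bar R :=
  ereal_inf [set L | pw_curve M g p q L].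

Definition riem_complete (R : realType) (n : nat) (M : set 'rV[R]_n)
    (g : 'rV[R]_n -> 'M[R]_n) : Prop :=
  forall x : nat -> 'rV[R]_n, (forall k, M (x k)) ->
    (forall e : R, 0 < e -> exists N : nat, forall i j : nat,
       (N <= i)%N -> (N <= j)%N -> (riem_dist M g (x i) (x j) < e%:E)%E) ->
    exists2 l, M l & riem_dist M g (x k) l @[k --> \oo] --> 0%E.

(** * Complex structure

    R^(n+n) has coordinates (u, v) and is identified with C^n by z = u + i v. *)

(* Acts on row vectors on the right: (a, b) |-> (- b, a), that is,
   J d_(u_i) = d_(v_i) and J d_(v_i) = - d_(u_i). *)
Definition Jmx (R : realType) (n : nat) : 'M[R]_(n + n) :=
  block_mx 0 1%:M (- 1%:M) 0.

(* Complex differentiability at every point: the real differential exists and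
   is C-linear. *)
Definition holomorphic (R : realType) (n m : nat) (U : set 'rV[R]_(n + n))
    (F : 'rV[R]_(n + n) -> 'rV[R]_(m + m)) : Prop :=
  forall p, U p -> differentiable F p /\
    forall w, 'd F p (w *m Jmx R n) = 'd F p w *m Jmx R m.

Definition biholomorphic (R : realType) (n m : nat)
    (U : set 'rV[R]_(n + n)) (V : set 'rV[R]_(m + m)) : Prop :=
  exists (F : 'rV[R]_(n + n) -> 'rV[R]_(m + m))
         (G : 'rV[R]_(m + m) -> 'rV[R]_(n + n)),
    [/\ forall p, U p -> V (F p) /\ G (F p) = p,
        forall q, V q -> U (G q) /\ F (G q) = q,
        holomorphic U F & holomorphic V G].

(* Every point of M is an isolated fixed point of an involutive holomorphic
   isometry of M. *)
Definition hermitian_symmetric (R : realType) (n : nat)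
    (M : set 'rV[R]_(n + n)) (g : 'rV[R]_(n + n) -> 'M[R]_(n + n)) : Prop :=
  forall p, M p -> exists s : 'rV[R]_(n + n) -> 'rV[R]_(n + n),
    [/\ forall q, M q -> M (s q) /\ s (s q) = q,
        smooth M s /\ holomorphic M s,
        forall q, M q -> forall x y,
          pairing (g (s q)) ('d s q x) ('d s q y) = pairing (g q) x y,
        s p = p &
        \forall q \near p, s q = q -> q = p].

(** * The Sasaki metric of a Hessian metric *)

Definition hessian (R : realType) (n : nat) (Psi : 'rV[R]_n -> R)
    (u : 'rV[R]_n) : 'M[R]_n :=
  \matrix_(i, j) partial i (partial j Psi) u.

(* The tangent bundle of Omega; (u, v) is the vector sum_i v_i d_(u_i) at u. *)
Definition tangent_bundle (R : realType) (n : nat) (Omega : set 'rV[R]_n) :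
    set 'rV[R]_(n + n) :=
  [set p | Omega (lsubmx p)].

Definition sasaki (R : realType) (n : nat) (Psi : 'rV[R]_n -> R)
    (p : 'rV[R]_(n + n)) : 'M[R]_(n + n) :=
  block_mx (hessian Psi (lsubmx p)) 0 0 (hessian Psi (lsubmx p)).

Definition real_vector (R : realType) (n : nat) (xi : 'rV[R]_n) :
    'rV[R]_(n + n) :=
  row_mx xi 0.

Definition anti_bisectional (R : realType) (n : nat) (Psi : 'rV[R]_n -> R)
    (p : 'rV[R]_(n + n)) (eta xi : 'rV[R]_n) : R :=
  let X := real_vector xi in
  let Y := real_vector eta in
  let JY := Y *m Jmx R n in
  Riem (sasaki Psi) p X JY X JY - Riem (sasaki Psi) p Y X Y X.

Definition NOAB (R : realType) (n : nat) (Omega : set 'rV[R]_n)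
    (Psi : 'rV[R]_n -> R) : Prop :=
  forall p, tangent_bundle Omega p -> forall xi eta : 'rV[R]_n,
    pairing (hessian Psi (lsubmx p)) xi eta = 0 ->
    0 <= anti_bisectional Psi p eta xi.

(** * The half-plane and its potential; u_1 is [u 0 0] and u_2 is [u 0 1] *)

Definition half_plane (R : realType) : set 'rV[R]_2 :=
  [set u : 'rV[R]_2 | u 0 1 < 0].

Definition potential (R : realType) (u : 'rV[R]_2) : R :=
  - (u 0 0 ^+ 2 / (4 * u 0 1)) - 2^-1 * ln (- 2 * u 0 1).
Arguments half_plane : clear implicits.
Arguments potential : clear implicits.

(* Main.v *)
Require Import Defs.
From HB Require Import structures.
From mathcomp Require Import all_boot all_order all_algebra.
From mathcomp Require Import all_classical all_reals all_analysis.
From mathcomp Require Import ring lra.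
Import Order.TTheory GRing.Theory Num.Theory.
Import numFieldNormedType.Exports.
Set Implicit Arguments.
Unset Strict Implicit.
Unset Printing Implicit Defensive.
Local Open Scope classical_set_scope.
Local Open Scope ring_scope.

(** Write z_k = u_k + i v_k, x = Re z_1, y = Re z_2.  The tangent bundle of the
half-plane is then the product of the complex plane (coordinate z_1) and the
left half-plane (coordinate z_2), and the Sasaki metric is
[|dz_1 - (x / y) dz_2|^2 / (- 2 y) + |dz_2|^2 / (2 y^2)]
([pairing_potential]).

No biholomorphism onto C^2.  The second coordinate of a holomorphic map from
C^2 to the bundle is an entire function with negative real part, hence constant
([Liouville_half_plane]), so the map is not onto.  Holomorphic means complex
differentiable, without continuity of the derivative, so Liouville's theorem is
derived from Goursat's bisection argument ([Goursat_circulation]).  For f entire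
and bounded, the function (f (p + e^w) - f p) e^(-w) of w is entire and
2 pi i - periodic, so its mean over a vertical period does not depend on Re w
([closed_form_mean]); it tends to f'(p) on the far left and to 0 on the far
right, whence f'(p) = 0 ([bounded_entire_diff]).

No symmetry.  Let s be an involutive holomorphic isometry fixing p.  By
Liouville the z_2-component of s is constant on each fibre z_2 = const
([base_constant]), and since s stretches a fibre by a constant factor
([fibre_scale]) it is complex affine on each fibre ([fibre_affine]).  Comparing
the cross terms of the metric along a fibre ([cross_term]) gives
[conj a * b = a] at p, where a is the derivative of s along the fibre and b the
derivative of its z_2-component; as a^2 = 1 this forces b = 1 ([dbase_fixed]).
The induced involution of the half-plane has derivative 1 at a fixed point, so it
is the identity near that point ([base_identity_near]).  Hence s maps each nearby
fibre to itself by an affine involution, which has a fixed point (a midpoint of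
an orbit), and p is not isolated ([fixed_point_not_isolated]).

Curvature.  The curvature of a Sasaki metric is expressed by the Christoffel
symbols of the Hessian metric on the base ([anti_bisectionalE]).  Here, with
a = xi_1 - (x / y) xi_2, b = xi_2 and c, d likewise for eta, one finds
[a^2 c^2 / (4 y^2) + a b c d / y^3 - b^2 d^2 / (2 y^4)]
([anti_bisectional_potential]); orthogonality reads b d = y a c, and the value
becomes 3 (a c / (2 y))^2.

Completeness.  The function - y - 1 / y + (x / y)^2 is an exhaustion of the
half-plane whose logarithm has bounded gradient ([log_exhaustion_bound]), and on
its sublevels the metric dominates a multiple of the Euclidean one
([coord_bound]).  A Cauchy sequence therefore stays in one sublevel and is
Cauchy for the Euclidean norm; near its limit straight segments are short
([riem_dist_segment]). *)

(** * Goursat's theorem for closed 1-forms on the plane *)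

(** First-order expansion of [P] at [(x, y)] with partial derivatives [a] and [c]. *)
Definition linear_approx (R : realType) (P : R -> R -> R) (x y a c : R) : Prop :=
  forall e, 0 < e -> exists2 r, 0 < r & forall s t,
    `|s - x| <= r -> `|t - y| <= r ->
    `|P s t - P x y - a * (s - x) - c * (t - y)| <= e * (`|s - x| + `|t - y|).

(** Mean value theorem for [F] minus the antiderivative of [k + l x]. *)
Lemma antiderivative_linear_error (R : realType) (F f : R -> R) (a b k l e : R) :
  a <= b -> (forall x, a <= x <= b -> is_derive x 1 F (f x)) ->
  (forall x, a <= x <= b -> `|f x - (k + l * x)| <= e) ->
  `|F b - F a - (k * (b - a) + l * (b ^+ 2 - a ^+ 2) / 2)| <= e * (b - a).
Proof.
move=> ab dF fe.
pose G x := F x - (k * x + l / 2 * x ^+ 2).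
have dG x : a <= x <= b -> is_derive x 1 G (f x - (k + l * x)).
  move=> /dF Fx; apply: is_derive_eq.
  by rewrite /GRing.scale /=; field.
have [c cab GE] : exists2 c, c \in `[a, b]%R & G b - G a = (f c - (k + l * c)) * (b - a).
  apply: MVT_segment => //.
    by move=> x /[!in_itv]/= /andP[ax xb]; apply: dG; rewrite !ltW.
  apply: derivable_within_continuous => x /[!in_itv]/= xab.
  by have := dG _ xab => -[].
have -> : F b - F a - (k * (b - a) + l * (b ^+ 2 - a ^+ 2) / 2) = G b - G a.
  by rewrite /G; field.
rewrite GE normrM [X in _ * X]ger0_norm ?subr_ge0 //.
by rewrite ler_wpM2r ?subr_ge0 //; apply: fe; rewrite in_itv in cab.
Qed.

(** Integral of the form P dx + S dy around the boundary of the rectangle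
    [[x1, x2] x [y1, y2]], where [PX] is an antiderivative of P in x and [SY] one
    of S in y.  With antiderivatives, additivity under subdivision is a ring
    identity. *)
Definition circulation (R : realType) (PX SY : R -> R -> R) (x1 x2 y1 y2 : R) : R :=
  (PX x2 y1 - PX x1 y1) + (SY x2 y2 - SY x2 y1)
  - (PX x2 y2 - PX x1 y2) - (SY x1 y2 - SY x1 y1).

Section Goursat.
Variables (R : realType) (P S PX SY : R -> R -> R) (A : R).
Hypothesis dPX : forall x y, A < x -> is_derive x 1 (PX^~ y) (P x y).
Hypothesis dSY : forall x y, A < y -> is_derive y 1 (SY x) (S x y).
Hypothesis closed : forall x y, exists a c d,
  linear_approx P x y a c /\ linear_approx S x y c d.

(** The affine parts of P and S have equal cross derivatives, so they contribute
    nothing; each of the four sides contributes at most its length times the error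
    [2 e h] of the affine approximation. *)
Lemma circulation_small (x0 y0 e : R) : A < x0 -> A < y0 -> 0 < e ->
  exists2 r, 0 < r & forall x1 x2 y1 y2 h, A < x1 -> A < y1 ->
    x1 <= x0 <= x2 -> y1 <= y0 <= y2 -> x2 - x1 <= h -> y2 - y1 <= h -> h <= r ->
    `|circulation PX SY x1 x2 y1 y2| <= 8 * e * h ^+ 2.
Proof.
move=> Ax0 Ay0 e0; have [a [c [d [Pl Sl]]]] := closed x0 y0.
have [r1 r10 P1] := Pl _ e0; have [r2 r20 S1] := Sl _ e0.
exists (Num.min r1 r2); first by rewrite lt_min r10.
move=> x1 x2 y1 y2 h Ax1 Ay1 /andP[x10 x02] /andP[y10 y02] xh yh.
rewrite le_min => /andP[hr1 hr2].
have x12 : x1 <= x2 by exact: le_trans x02.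
have y12 : y1 <= y2 by exact: le_trans y02.
have h0 : 0 <= h by rewrite (le_trans _ xh) // subr_ge0.
have nx x : x1 <= x <= x2 -> `|x - x0| <= h by move=> ?; rewrite ler_norml; lra.
have ny y : y1 <= y <= y2 -> `|y - y0| <= h by move=> ?; rewrite ler_norml; lra.
have eh (u v : R) : `|u| <= h -> `|v| <= h -> e * (`|u| + `|v|) <= 2 * e * h.
  by move=> uh vh; rewrite -mulrA mulrCA ler_pM2l //; lra.
have sideP y : y1 <= y <= y2 ->
  `|PX x2 y - PX x1 y - ((P x0 y0 - a * x0 + c * (y - y0)) * (x2 - x1)
      + a * (x2 ^+ 2 - x1 ^+ 2) / 2)| <= 2 * e * h * (x2 - x1).
  move=> yy; apply: (antiderivative_linear_error (F := PX^~ y) (f := P^~ y)) => // x xx.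
    by apply: dPX; case/andP: xx => xx _; exact: lt_le_trans xx.
  apply: (le_trans _ (eh _ _ (nx _ xx) (ny _ yy))).
  apply: (le_trans _ (P1 x y (le_trans (nx _ xx) hr1) (le_trans (ny _ yy) hr1))).
  by rewrite le_eqVlt; apply/orP; left; apply/eqP; congr `|_|; ring.
have sideS x : x1 <= x <= x2 ->
  `|SY x y2 - SY x y1 - ((S x0 y0 - d * y0 + c * (x - x0)) * (y2 - y1)
      + d * (y2 ^+ 2 - y1 ^+ 2) / 2)| <= 2 * e * h * (y2 - y1).
  move=> xx; apply: (antiderivative_linear_error (F := SY x) (f := S x)) => // y yy.
    by apply: dSY; case/andP: yy => yy _; exact: lt_le_trans yy.
  apply: (le_trans _ (eh _ _ (nx _ xx) (ny _ yy))).
  apply: (le_trans _ (S1 x y (le_trans (nx _ xx) hr2) (le_trans (ny _ yy) hr2))).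
  by rewrite le_eqVlt; apply/orP; left; apply/eqP; congr `|_|; ring.
have := sideP y1; have := sideP y2; have := sideS x1; have := sideS x2.
rewrite !lexx x12 y12 => /(_ isT) + /(_ isT) + /(_ isT) + /(_ isT).
have eh0 : 0 <= 2 * e * h by rewrite !mulr_ge0 // ltW.
have hx := ler_wpM2l eh0 xh; have hy := ler_wpM2l eh0 yh.
have -> : 8 * e * h ^+ 2 = 4 * (2 * e * h * h) by ring.
rewrite /circulation !ler_norml.
set k := 2 * e * h * h in hx hy *.
move=> /andP[s2l s2u] /andP[s1l s1u] /andP[p2l p2u] /andP[p1l p1u].
move: s2l s2u s1l s1u p2l p2u p1l p1u.
move: (2 * e * h * (x2 - x1)) (2 * e * h * (y2 - y1)) hx hy => kx ky hx hy.
by move=> *; apply/andP; split; lra.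
Qed.

Lemma circulation_split x y w v :
  circulation PX SY x (x + w) y (y + v) =
  circulation PX SY x (x + w / 2) y (y + v / 2)
  + circulation PX SY (x + w / 2) (x + w / 2 + w / 2) y (y + v / 2)
  + circulation PX SY x (x + w / 2) (y + v / 2) (y + v / 2 + v / 2)
  + circulation PX SY (x + w / 2) (x + w / 2 + w / 2) (y + v / 2) (y + v / 2 + v / 2).
Proof.
have half (a q : R) : a + q / 2 + q / 2 = a + q by field.
by rewrite !half /circulation; ring.
Qed.

(** One of the four quarters of a rectangle carries at least a quarter of the
    circulation. *)
Lemma circulation_quarter (z : R * R) w v : exists z' : R * R,
  [/\ z'.1 = z.1 \/ z'.1 = z.1 + w / 2, z'.2 = z.2 \/ z'.2 = z.2 + v / 2 &
   `|circulation PX SY z.1 (z.1 + w) z.2 (z.2 + v)| <=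
    4 * `|circulation PX SY z'.1 (z'.1 + w / 2) z'.2 (z'.2 + v / 2)|].
Proof.
case: z => x y /=; rewrite circulation_split.
set q1 := circulation _ _ _ _ _ _; set q2 := circulation _ _ _ _ _ _.
set q3 := circulation _ _ _ _ _ _; set q4 := circulation _ _ _ _ _ _.
have := ler_normD (q1 + q2 + q3) q4; have := ler_normD (q1 + q2) q3.
have := ler_normD q1 q2 => n1 n2 n3.
have [m1|m1] := lerP `|q1 + q2 + q3 + q4| (4 * `|q1|); first by exists (x, y); split; auto.
have [m2|m2] := lerP `|q1 + q2 + q3 + q4| (4 * `|q2|).
  by exists (x + w / 2, y); split => /=; auto.
have [m3|m3] := lerP `|q1 + q2 + q3 + q4| (4 * `|q3|).
  by exists (x, y + v / 2); split => /=; auto.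
exists (x + w / 2, y + v / 2); split => /=; auto.
by rewrite -/q4; lra.
Qed.

(** The limit of a bisection: at each step the left or the right half is kept. *)
Lemma nested_intervals (u : nat -> R) (w : R) : 0 <= w ->
  (forall n, u n.+1 = u n \/ u n.+1 = u n + w / 2 ^+ n / 2) ->
  exists l, forall n, u n <= l <= u n + w / 2 ^+ n.
Proof.
move=> w0 uS.
have wn n : 0 <= w / 2 ^+ n by rewrite divr_ge0 // exprn_ge0.
have wS n : w / 2 ^+ n.+1 = w / 2 ^+ n / 2 by rewrite exprSr invfM mulrA.
have step n : u n <= u n.+1 /\ u n.+1 + w / 2 ^+ n.+1 <= u n + w / 2 ^+ n.
  by have := wn n; rewrite wS; case: (uS n) => ->; split; lra.
have mono n k : u n <= u (n + k)%N /\ u (n + k)%N + w / 2 ^+ (n + k) <= u n + w / 2 ^+ n.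
  elim: k => [|k [IH1 IH2]]; first by rewrite addn0.
  by have [s1 s2] := step (n + k)%N; rewrite addnS; split;
    [exact: le_trans s1 | exact: le_trans IH2].
have ub n m : u m <= u n + w / 2 ^+ n.
  have [mn|/ltnW nm] := leqP m n.
    by have [h _] := mono m (n - m)%N; rewrite subnKC // in h; have := wn n; lra.
  have [_ h] := mono n (m - n)%N; rewrite subnKC // in h.
  by have := wn m; lra.
exists (sup (range u)) => n; apply/andP; split.
  apply: ub_le_sup; last by exists n.
  by exists (u 0%N + w / 2 ^+ 0) => _ [m _ <-].
apply: ge_sup; first by exists (u 0%N), 0%N.
by move=> _ [m _ <-].
Qed.

(** Bisect, keeping a quarter with large circulation.  The circulation decreases
    at most by 4 at each step, and near the limit point it is smaller than any
    multiple of the area. *)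
Lemma Goursat_circulation x y w v : A < x -> A < y -> 0 <= w -> 0 <= v ->
  circulation PX SY x (x + w) y (y + v) = 0.
Proof.
move=> Ax Ay w0 v0.
have /choice[step stepP] : forall q : R * R * R * R, exists z' : R * R,
    let: (x, y, w, v) := q in
    [/\ z'.1 = x \/ z'.1 = x + w / 2, z'.2 = y \/ z'.2 = y + v / 2 &
   `|circulation PX SY x (x + w) y (y + v)| <=
    4 * `|circulation PX SY z'.1 (z'.1 + w / 2) z'.2 (z'.2 + v / 2)|].
  by move=> [[[x' y'] w'] v']; exact: (circulation_quarter (x', y')).
pose z := fix z n := if n is m.+1 then step (z m, w / 2 ^+ m, v / 2 ^+ m)
  else (x, y).
have zS n : [/\ (z n.+1).1 = (z n).1 \/ (z n.+1).1 = (z n).1 + w / 2 ^+ n / 2,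
    (z n.+1).2 = (z n).2 \/ (z n.+1).2 = (z n).2 + v / 2 ^+ n / 2 &
  `|circulation PX SY (z n).1 ((z n).1 + w / 2 ^+ n) (z n).2 ((z n).2 + v / 2 ^+ n)| <=
    4 * `|circulation PX SY (z n.+1).1 ((z n.+1).1 + w / 2 ^+ n / 2)
       (z n.+1).2 ((z n.+1).2 + v / 2 ^+ n / 2)|].
  by have := stepP (z n, w / 2 ^+ n, v / 2 ^+ n); rewrite /=; case: (z n).
have [X Xn] := @nested_intervals (fun n => (z n).1) w w0
  (fun n => let: And3 h _ _ := zS n in h).
have [Y Yn] := @nested_intervals (fun n => (z n).2) v v0
  (fun n => let: And3 _ h _ := zS n in h).
have zlo n : x <= (z n).1 /\ y <= (z n).2.
  elim: n => [|n [IH1 IH2]] //; have [h1 h2 _] := zS n.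
  have p (q : R) : 0 <= q -> 0 <= q / 2 ^+ n / 2 by move=> q0; rewrite !divr_ge0.
  have := p _ w0; have := p _ v0.
  by split; [case: h1 => -> | case: h2 => ->]; lra.
have decay n : `|circulation PX SY x (x + w) y (y + v)| <= 4 ^+ n *
   `|circulation PX SY (z n).1 ((z n).1 + w / 2 ^+ n) (z n).2 ((z n).2 + v / 2 ^+ n)|.
  elim: n => [|n IH]; first by rewrite !expr0 !divr1 mul1r.
  apply: le_trans IH _; have [_ _ h] := zS n.
  rewrite exprSr -mulrA ler_pM2l ?exprn_gt0 //.
  have E (q : R) : q / 2 ^+ n.+1 = q / 2 ^+ n / 2 by rewrite exprSr invfM mulrA.
  by rewrite !E.
apply/eqP; rewrite -normr_le0; apply/ler_addgt0Pl => e e0; rewrite addr0.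
(* At level n both sides are at most D / 2^n; the summand 1 makes D positive. *)
pose D := w + v + 1.
have D0 : 0 < D by rewrite /D; lra.
have e'0 : 0 < e / (8 * D ^+ 2) by rewrite divr_gt0 // mulr_gt0 // exprn_gt0.
have AX : A < X by have /andP[h _] := Xn 0%N; exact: lt_le_trans h.
have AY : A < Y by have /andP[h _] := Yn 0%N; exact: lt_le_trans h.
have [r r0 small] := circulation_small AX AY e'0.
have [n nr] : exists n, D / 2 ^+ n <= r.
  have [N hN] : exists N, D / r < N%:R.
    by exists (Num.truncn (D / r)).+1; exact: truncnS_gt.
  exists N; rewrite ler_pdivrMr ?exprn_gt0 // mulrC -ler_pdivrMr //.
  rewrite (le_trans (ltW hN)) // -natrX ler_nat ltnW //; exact: ltn_expl.
apply: le_trans (decay n) _.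
have [xlo ylo] := zlo n.
have Dn (q : R) : 0 <= q -> q <= D -> q / 2 ^+ n <= D / 2 ^+ n.
  by move=> q0 qD; rewrite ler_pM2r // invr_gt0 exprn_gt0.
have := small (z n).1 ((z n).1 + w / 2 ^+ n) (z n).2 ((z n).2 + v / 2 ^+ n)
  (D / 2 ^+ n) (lt_le_trans Ax xlo) (lt_le_trans Ay ylo) (Xn n) (Yn n).
rewrite ![_ + _ / _ - _]addrAC !subrr !add0r => /(_ _ _ nr) h.
have wD : w <= D by rewrite /D; lra.
have vD : v <= D by rewrite /D; lra.
have {h} := h (Dn _ w0 wD) (Dn _ v0 vD).
rewrite -(ler_pM2l (_ : 0 < 4 ^+ n)) ?exprn_gt0 // => h.
apply: le_trans h _.
rewrite le_eqVlt; apply/orP; left; apply/eqP.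
have -> : (4 : R) ^+ n = (2 ^+ n) ^+ 2 by rewrite -exprM mulnC exprM; congr (_ ^+ n); ring.
have p0 : (2 : R) ^+ n != 0 by rewrite expf_neq0 // pnatr_eq0.
have Dn0 : D != 0 by rewrite gt_eqF.
have cancel (p d : R) : p != 0 -> d != 0 ->
  p ^+ 2 * (8 * (e / (8 * d ^+ 2)) * (d / p) ^+ 2) = e.
  by move=> p0' d0; field; rewrite p0' d0.
exact: cancel.
Qed.
End Goursat.

(** * Means of closed periodic forms *)

Lemma row_norm_le (R : realType) n (p : 'rV[R]_n) (c : R) :
  0 <= c -> (forall j, `|p 0 j| <= c) -> `|p| <= c.
Proof.
move=> c0 pc; rewrite /Num.Def.normr /= mx_normrE (bigmax_le _ c0) // => -[i j] _ /=.
by rewrite (ord1 i).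
Qed.

Lemma coord_norm_le (R : realType) n (p : 'rV[R]_n) j : `|p 0 j| <= `|p|.
Proof.
rewrite [leRHS]/Num.Def.normr /= mx_normrE.
by apply: le_trans (le_bigmax _ _ (0, j)).
Qed.

(** For a closed form P dx + S dy with P periodic in y, the integrals of P over the
    two horizontal sides of a rectangle of height [T] cancel.  So the integral of S
    over a vertical period does not depend on x, and neither does its mean. *)
Lemma closed_form_mean (R : realType) (P S : R -> R -> R) (T x1 x2 a b e e' : R) :
  (forall x y, exists a c d, linear_approx P x y a c /\ linear_approx S x y c d) ->
  (forall y, continuous (P^~ y)) -> (forall x, continuous (S x)) ->
  0 < T -> (forall x y, P x (y + T) = P x y) -> x1 <= x2 ->
  (forall y, `|S x1 y - a| <= e) -> (forall y, `|S x2 y - b| <= e') ->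
  `|a - b| <= e + e'.
Proof.
move=> closed cP cS T0 PT x12 Sa Sb.
(* The antiderivatives are integrals from a base point left of the rectangle. *)
pose A := Num.min x1 0 - 1.
have m1 : Num.min x1 0 <= x1 by rewrite ge_min lexx.
have m0 : Num.min x1 0 <= 0 by rewrite ge_min lexx orbT.
have Ax1 : A < x1 by rewrite /A; lra.
have A0 : A < 0 by rewrite /A; lra.
have antider (f : R -> R) : continuous f ->
    forall x, A < x -> is_derive x 1 (fun x => \int[lebesgue_measure]_(t in `[A, x]) f t)%R (f x).
  move=> cf x Ax.
  have intf : lebesgue_measure.-integrable `[A, x + 1] (EFin \o f).
    apply: continuous_compact_integrable; first exact: segment_compact.
    exact: continuous_subspaceT.
  have xx1 : x < x + 1 by rewrite ltrDl.
  have [dF F'] := continuous_FTC1_closed xx1 intf Ax (cf x).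
  by rewrite -F' derive1E; exact/derivableP.
pose PX x y := (\int[lebesgue_measure]_(t in `[A, x]) P t y)%R.
pose SY x y := (\int[lebesgue_measure]_(t in `[A, y]) S x t)%R.
have dPX x y : A < x -> is_derive x 1 (PX^~ y) (P x y).
  by move=> Ax; exact: (antider (P^~ y)).
have dSY x y : A < y -> is_derive y 1 (SY x) (S x y).
  by move=> Ay; exact: (antider (S x)).
have w0 : 0 <= x2 - x1 by rewrite subr_ge0.
have := Goursat_circulation dPX dSY closed Ax1 A0 w0 (ltW T0).
rewrite add0r addrC subrK /circulation.
have PXT x : PX x T = PX x 0 by rewrite /PX; apply: eq_Rintegral => t _; rewrite -{1}(add0r T) PT.
rewrite !PXT => circ.
have mean x k d : (forall y, `|S x y - k| <= d) -> `|SY x T - SY x 0 - k * T| <= d * T.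
  move=> Sk.
  have := @antiderivative_linear_error _ (SY x) (S x) 0 T k 0 d (ltW T0).
  rewrite subr0 !mul0r addr0; apply.
    by move=> y /andP[y0 _]; apply: dSY; exact: lt_le_trans y0.
  by move=> y _; rewrite mul0r addr0.
have := mean _ _ _ Sa; have := mean _ _ _ Sb.
suff : `|(a - b) * T| <= e * T + e' * T -> `|a - b| <= e + e'.
  move=> sf h1 h2; apply: sf; move: h1 h2.
  rewrite mulrBl !ler_norml => /andP[h1 h2] /andP[h3 h4].
  by move: circ h1 h2 h3 h4; clear;
    move: (SY x1 T) (SY x1 0) (SY x2 T) (SY x2 0) (PX x1 0) (PX x2 0);
    move=> *; apply/andP; split; lra.
by rewrite normrM (gtr0_norm T0) -mulrDl ler_pM2r.
Qed.

Lemma linear_approxP (R : realType) (F : 'rV[R]_(1 + 1) -> R) (x y : R) :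
  let pt s t : 'rV[R]_(1 + 1) := row_mx s%:M t%:M in
  differentiable F (pt x y) ->
  linear_approx (fun s t => F (pt s t)) x y
    ('d F (pt x y) (pt 1 0)) ('d F (pt x y) (pt 0 1)).
Proof.
move=> pt dF e e0; have /eqaddoP o := diff_locally dF.
have {o} := o _ e0; case/nbhs_ballP => r /= r0 Br.
exists (r / 3); first by rewrite divr_gt0.
move=> s t sx ty.
have hE : pt s t = (s - x) *: pt 1 0 + (t - y) *: pt 0 1 + pt x y.
  rewrite /pt !scale_row_mx !add_row_mx !scale_scalar_mx; congr row_mx;
  by rewrite -!raddfD /=; congr (_%:M); ring.
have nh : `|(s - x) *: pt 1 0 + (t - y) *: pt 0 1| <= `|s - x| + `|t - y|.
  have n1 (a b : R) : `|pt a b| <= `|a| + `|b|.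
    apply: row_norm_le => [|j]; first by rewrite addr_ge0.
    rewrite /pt mxE; case: splitP => k _; rewrite !mxE.
      by case: (_ == _); rewrite ?mulr0n ?mulr1n ?normr0 ?addr_ge0 // lerDl.
    by case: (_ == _); rewrite ?mulr0n ?mulr1n ?normr0 ?addr_ge0 // lerDr.
  apply: le_trans (ler_normD _ _) _; rewrite !normrZ.
  have := n1 1 0; have := n1 0 1; rewrite normr0 normr1 addr0 add0r => h1 h2.
  by rewrite lerD // ler_piMr.
set h := _ + _ in nh hE.
have Bh : ball_ Num.norm 0 r h by rewrite /= sub0r normrN (le_lt_trans nh) //; move: sx ty r0; clear; lra.
have := Br h; rewrite -ball_normE => /(_ Bh).
rewrite (_ : (_ - _) h = F (pt s t) - (F (pt x y) + 'd F (pt x y) h)); last by rewrite hE.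
move=> near_h; apply: (@le_trans _ _ (e * `|h|)); last by rewrite ler_pM2l.
have dh : 'd F (pt x y) h =
    'd F (pt x y) (pt 1 0) * (s - x) + 'd F (pt x y) (pt 0 1) * (t - y).
  by rewrite /h [LHS]linearD !linearZ /= /GRing.scale /= ![_ * 'd F _ _]mulrC.
apply: le_trans near_h; rewrite dh.
rewrite le_eqVlt; apply/orP; left; apply/eqP; congr `|_|.
by rewrite !opprD !addrA.
Qed.

(** * The Cauchy-Riemann equations *)

(** [U + i V] is complex differentiable at [p].  The differentials are existentially
    quantified: the closure properties below then never need to compare two terms
    of the form ['d f p]. *)
Definition cauchy_riemann (R : realType) n (U V : 'rV[R]_(n + n) -> R)
    (p : 'rV[R]_(n + n)) : Prop :=
  exists dU dV : 'rV[R]_(n + n) -> R, [/\ is_diff p U dU, is_diff p V dV &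
    forall w, dU (w *m Jmx R n) = - dV w /\ dV (w *m Jmx R n) = dU w].

Section CauchyRiemann.
Variable R : realType.

Lemma lsubmxJ n (w : 'rV[R]_(n + n)) : lsubmx (w *m Jmx R n) = - rsubmx w.
Proof.
rewrite -{1}[w]hsubmxK /Jmx mul_row_block row_mxKl.
by rewrite mulmx0 add0r mulmxN mulmx1.
Qed.

Lemma rsubmxJ n (w : 'rV[R]_(n + n)) : rsubmx (w *m Jmx R n) = lsubmx w.
Proof.
rewrite -{1}[w]hsubmxK /Jmx mul_row_block row_mxKr.
by rewrite mulmx0 addr0 mulmx1.
Qed.

Lemma mulJJ n (w : 'rV[R]_(n + n)) : w *m Jmx R n *m Jmx R n = - w.
Proof.
by rewrite -[LHS]hsubmxK lsubmxJ rsubmxJ lsubmxJ rsubmxJ -opp_row_mx hsubmxK.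
Qed.

Lemma diff_coord n (f : 'rV[R]_n -> R) (p : 'rV[R]_n) : linear_for *%R f ->
  continuous f -> is_diff p f f.
Proof.
move=> lf cf; pose fM := GRing.isLinear.Build R _ _ _ f lf.
pose fL : {linear 'rV[R]_n -> R} := HB.pack f fM.
by split; [exact: (@linear_differentiable _ _ _ fL) | exact: (@diff_lin _ _ _ fL)].
Qed.

Lemma is_diff_re n k (p : 'rV[R]_(n + n)) :
  is_diff p (fun q : 'rV[R]_(n + n) => lsubmx q 0 k) (fun q => lsubmx q 0 k).
Proof.
apply: diff_coord; first by move=> a u v; rewrite !mxE.
have -> : (fun q : 'rV[R]_(n + n) => lsubmx q 0 k) = (fun q => q 0 (lshift n k)).
  by apply/funext => q; rewrite mxE.
exact: coord_continuous.
Qed.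

Lemma is_diff_im n k (p : 'rV[R]_(n + n)) :
  is_diff p (fun q : 'rV[R]_(n + n) => rsubmx q 0 k) (fun q => rsubmx q 0 k).
Proof.
apply: diff_coord; first by move=> a u v; rewrite !mxE.
have -> : (fun q : 'rV[R]_(n + n) => rsubmx q 0 k) = (fun q => q 0 (rshift n k)).
  by apply/funext => q; rewrite mxE.
exact: coord_continuous.
Qed.

Lemma holomorphic_cr n m (M : set 'rV[R]_(n + n)) (F : 'rV[R]_(n + n) -> 'rV[R]_(m + m))
    (k : 'I_m) p : holomorphic M F -> M p ->
  cauchy_riemann (fun q => lsubmx (F q) 0 k) (fun q => rsubmx (F q) 0 k) p.
Proof.
move=> hF Mp; have [dF FJ] := hF _ Mp.
have iF := differentiableP dF.
have := is_diff_comp iF (is_diff_re k (F p)); have := is_diff_comp iF (is_diff_im k (F p)).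
move=> ? ?; do 2 eexists; split; [eassumption|eassumption|move=> w /=].
by rewrite FJ lsubmxJ rsubmxJ mxE.
Qed.

Lemma cauchy_riemann_coord n k (p : 'rV[R]_(n + n)) :
  cauchy_riemann (fun q => lsubmx q 0 k) (fun q => rsubmx q 0 k) p.
Proof.
do 2 eexists; split; [exact: is_diff_re|exact: is_diff_im|move=> w /=].
by rewrite lsubmxJ rsubmxJ mxE.
Qed.

Lemma cauchy_riemann_cst n (a b : R) (p : 'rV[R]_(n + n)) :
  cauchy_riemann (cst a) (cst b) p.
Proof.
exists (cst 0), (cst 0); split; [exact: is_diff_cst|exact: is_diff_cst|move=> w].
by rewrite /cst oppr0.
Qed.

Lemma cauchy_riemannD n (U V U' V' : 'rV[R]_(n + n) -> R) p :
  cauchy_riemann U V p -> cauchy_riemann U' V' p ->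
  cauchy_riemann (fun q => U q + U' q) (fun q => V q + V' q) p.
Proof.
move=> [dU [dV [iU iV J]]] [dU' [dV' [iU' iV' J']]].
exists (dU + dU'), (dV + dV'); split; [exact: is_diffD|exact: is_diffD|move=> w].
have [J1 J2] := J w; have [J1' J2'] := J' w.
by rewrite !fctE J1 J2 J1' J2' opprD.
Qed.

Lemma cauchy_riemannM n (U V U' V' : 'rV[R]_(n + n) -> R) p :
  cauchy_riemann U V p -> cauchy_riemann U' V' p ->
  cauchy_riemann (fun q => U q * U' q - V q * V' q)
    (fun q => U q * V' q + V q * U' q) p.
Proof.
move=> [dU [dV [iU iV J]]] [dU' [dV' [iU' iV' J']]].
have iUU := is_diffM iU iU'; have iVV := is_diffM iV iV'.
have iUV := is_diffM iU iV'; have iVU := is_diffM iV iU'.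
do 2 eexists; split; [exact: (is_diffB iUU iVV)|exact: (is_diffD iUV iVU)|move=> w].
have [J1 J2] := J w; have [J1' J2'] := J' w.
by rewrite !fctE /GRing.scale /= J1 J2 J1' J2'; split; ring.
Qed.

(** Multiplication by - i. *)
Lemma cauchy_riemann_rot n (U V : 'rV[R]_(n + n) -> R) p :
  cauchy_riemann U V p -> cauchy_riemann V (fun q => - U q) p.
Proof.
move=> [dU [dV [iU iV J]]].
exists dV, (- dU); split; [by []|exact: is_diffN|move=> w].
by have [J1 J2] := J w; rewrite !fctE J1 J2 !opprK.
Qed.

(** Composition of [U + i V] with the map [w |-> q + (U0 w + i V0 w) d] into a
    complex line. *)
Lemma cauchy_riemann_comp n m (U V : 'rV[R]_(n + n) -> R)
    (U0 V0 : 'rV[R]_(m + m) -> R) (q d : 'rV[R]_(n + n)) w :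
  let h w := q + (U0 w *: d + V0 w *: (d *m Jmx R n)) in
  cauchy_riemann U0 V0 w -> cauchy_riemann U V (h w) ->
  cauchy_riemann (fun w => U (h w)) (fun w => V (h w)) w.
Proof.
move=> h [dU0 [dV0 [iU0 iV0 J0]]] [dU [dV [iU iV J]]].
have dh : is_diff w h (fun x => dU0 x *: d + dV0 x *: (d *m Jmx R n)).
  have iU1 : is_diff w (fun x => U0 x *: d) (fun x => dU0 x *: d).
    exact: (is_diff_comp iU0 (is_diff_scalel _ _)).
  have iV1 : is_diff w (fun x => V0 x *: (d *m Jmx R n)) (fun x => dV0 x *: (d *m Jmx R n)).
    exact: (is_diff_comp iV0 (is_diff_scalel _ _)).
  have := is_diffD (is_diff_cst q w) (is_diffD iU1 iV1).
  by rewrite add0r.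
do 2 eexists; split; [exact: (is_diff_comp dh iU)|exact: (is_diff_comp dh iV)|].
move=> x /=; have [J1 J2] := J0 x; rewrite J1 J2.
have -> : - dV0 x *: d + dU0 x *: (d *m Jmx R n) =
   (dU0 x *: d + dV0 x *: (d *m Jmx R n)) *m Jmx R n.
  by rewrite mulmxDl -!scalemxAl mulJJ scalerN scaleNr addrC.
exact: J.
Qed.

End CauchyRiemann.

(** * Liouville's theorem *)

Section Liouville.
Variable R : realType.

Lemma is_derive_is_diff (f : R -> R) (x d : R) : is_derive x 1 f d ->
  is_diff x f (fun h => h * d).
Proof.
move=> [df fd]; have dif : differentiable f x by exact/derivable1_diffP.
by split => //; rewrite diff1E // derive1E fd.
Qed.

(** The exponential of [U + i V]. *)
Lemma cauchy_riemann_exp n (U V : 'rV[R]_(n + n) -> R) p :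
  cauchy_riemann U V p ->
  cauchy_riemann (fun q => expR (U q) * cos (V q)) (fun q => expR (U q) * sin (V q)) p.
Proof.
move=> [dU [dV [iU iV J]]].
have ie := is_diff_comp iU (is_derive_is_diff (is_derive_expR (U p))).
have ic := is_diff_comp iV (is_derive_is_diff (is_derive_cos (V p))).
have isn := is_diff_comp iV (is_derive_is_diff (is_derive_sin (V p))).
do 2 eexists; split; [exact: is_diffM ie ic|exact: is_diffM ie isn|move=> w].
have [J1 J2] := J w.
by rewrite !fctE /GRing.scale /= J1 J2; split; ring.
Qed.

(** The inverse of [U + i V]. *)
Lemma cauchy_riemannV n (U V : 'rV[R]_(n + n) -> R) p :
  U p ^+ 2 + V p ^+ 2 != 0 -> cauchy_riemann U V p ->
  cauchy_riemann (fun q => U q * (U q ^+ 2 + V q ^+ 2)^-1)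
    (fun q => - V q * (U q ^+ 2 + V q ^+ 2)^-1) p.
Proof.
move=> N0 [dU [dV [iU iV J]]].
have iN := is_diffD (is_diffX 1 iU) (is_diffX 1 iV).
have iI : is_diff ((U ^+ 2 + V ^+ 2) p) GRing.inv (fun h => - (U p ^+ 2 + V p ^+ 2) ^- 2 *: h).
  by split; [exact: differentiable_Rinv | exact: diff_Rinv].
have iNI := is_diff_comp iN iI.
do 2 eexists; split.
- exact: is_diffM iU iNI.
- exact: is_diffM (is_diffN iV) iNI.
move=> w; have [J1 J2] := J w.
rewrite !fctE /GRing.scale /= !J1 !J2.
set N := _ + _ in N0 *; rewrite !expr1.
have -> : N ^- 2 = N^-1 * N^-1 by rewrite expr2 invfM.
have NN : N * (N^-1 * N^-1) = N^-1 by rewrite mulrA divff // mul1r.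
move: (N^-1) NN => I NN; split; apply/eqP; rewrite -subr_eq0; apply/eqP.
- by transitivity (2 * dV w * (N * (I * I) - I));
    [rewrite /N; ring | rewrite NN subrr mulr0].
- by transitivity (2 * dU w * (N * (I * I) - I));
    [rewrite /N; ring | rewrite NN subrr mulr0].
Qed.

Lemma diff0_cst n (U : 'rV[R]_n -> R) : (forall p, is_diff p U (cst 0)) ->
  forall p q, U p = U q.
Proof.
move=> U0 p q; pose g t := U (p + t *: (q - p)).
have dg (t : R) : is_derive t 1 g 0.
  have il : is_diff t (fun t : R => p + t *: (q - p)) ( *:%R ^~ (q - p)).
    by have := is_diffD (is_diff_cst p t) (is_diff_scalel t (q - p)); rewrite add0r.
  have ig := is_diff_comp il (U0 (p + t *: (q - p))).
  have dif : differentiable g t by exact: ex_diff.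
  split; first exact: diff_derivable.
  by rewrite deriveE // (diff_val (is_diff_def := ig)).
have := @is_derive_0_is_cst _ g 0 1 dg.
by rewrite /g scale0r addr0 scale1r addrC subrK.
Qed.

Let pt (x y : R) : 'rV[R]_(1 + 1) := row_mx x%:M y%:M.

Lemma lsubmx_pt x y : lsubmx (pt x y) 0 0 = x.
Proof. by rewrite /pt row_mxKl mxE mulr1n. Qed.

Lemma rsubmx_pt x y : rsubmx (pt x y) 0 0 = y.
Proof. by rewrite /pt row_mxKr mxE mulr1n. Qed.

Lemma pt_coord p : p = pt (lsubmx p 0 0) (rsubmx p 0 0).
Proof. by rewrite -[LHS]hsubmxK /pt -!mx11_scalar. Qed.

Lemma pt_mulJ x y : pt x y *m Jmx R 1 = pt (- y) x.
Proof.
rewrite [LHS]pt_coord lsubmxJ rsubmxJ mxE.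
by rewrite lsubmx_pt rsubmx_pt.
Qed.

(** With f = U + i V, the function S + i T of w is (f (p + e^w) - f p) e^(-w).  The
    form T dx + S dy is closed by the Cauchy-Riemann equations and periodic in
    y = Im w.  As x tends to minus infinity S tends to Re f'(p), and as x tends to
    plus infinity it tends to 0 because f is bounded. *)
Lemma bounded_entire_diff (U V : 'rV[R]_(1 + 1) -> R) K p :
  (forall q, cauchy_riemann U V q) ->
  (forall q, `|U q| <= K) -> (forall q, `|V q| <= K) -> 'd U p (pt 1 0) = 0.
Proof.
move=> crUV UK VK; rewrite (pt_coord p).
move: (lsubmx p 0 0) (rsubmx p 0 0) => px py {p}; set p := pt px py.
pose re (w : 'rV[R]_(1 + 1)) := lsubmx w 0 0.
pose im (w : 'rV[R]_(1 + 1)) := rsubmx w 0 0.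
have cr_id w : cauchy_riemann re im w by exact: cauchy_riemann_coord.
have cr_opp w : cauchy_riemann (fun w => - re w) (fun w => - im w) w.
  by apply: cauchy_riemann_rot; apply: cauchy_riemann_rot.
have cr_e w := cauchy_riemann_exp (cr_id w).
have cr_n w := cauchy_riemann_exp (cr_opp w).
pose h w := p + ((expR (re w) * cos (im w)) *: pt 1 0
                 + (expR (re w) * sin (im w)) *: (pt 1 0 *m Jmx R 1)).
have cr_h w : cauchy_riemann (fun w => U (h w) + - U p) (fun w => V (h w) + - V p) w.
  apply: cauchy_riemannD; last exact: cauchy_riemann_cst.
  exact: cauchy_riemann_comp.
have cr_ST w := cauchy_riemannM (cr_n w) (cr_h w).
set S := (fun q => _ - _) in cr_ST; set T := (fun q => _ + _) in cr_ST.
have hE x y : h (pt x y) = pt (px + expR x * cos y) (py + expR x * sin y).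
  rewrite /h /re /im lsubmx_pt rsubmx_pt /p pt_mulJ oppr0 /pt.
  rewrite !scale_row_mx !add_row_mx !scale_scalar_mx mulr1 mulr0 !raddfD /= !raddf0.
  by rewrite mulr0 mulr1 !raddf0 addr0 add0r.
have closed x y : exists a c d, linear_approx (fun x y => T (pt x y)) x y a c
    /\ linear_approx (fun x y => S (pt x y)) x y c d.
  have [dS [dT [iS iT J]]] := cr_ST (pt x y).
  have LS := linear_approxP (ex_diff (is_diff_def := iS)).
  have LT := linear_approxP (ex_diff (is_diff_def := iT)).
  do 3 eexists; split; first exact: LT.
  rewrite (_ : 'd T _ _ = 'd S (pt x y) (pt 1 0)); first exact: LS.
  have -> : 'd S (pt x y) (pt 1 0) = dS (pt 1 0) by have -> := diff_val (is_diff_def := iS).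
  have -> : 'd T (pt x y) (pt 0 1) = dT (pt 0 1) by have -> := diff_val (is_diff_def := iT).
  by have [_ <-] := J (pt 1 0); rewrite pt_mulJ oppr0.
have [dU [dV [iU iV J]]] := crUV p.
have [J1 J2] := J (pt 1 0); rewrite pt_mulJ oppr0 in J1 J2.
have LU : linear_approx (fun s t => U (pt s t)) px py (dU (pt 1 0)) (- dV (pt 1 0)).
  rewrite -J1 -(diff_val (is_diff_def := iU)); apply: linear_approxP; exact: ex_diff.
have LV : linear_approx (fun s t => V (pt s t)) px py (dV (pt 1 0)) (dU (pt 1 0)).
  rewrite -J2 -(diff_val (is_diff_def := iV)); apply: linear_approxP; exact: ex_diff.
rewrite (diff_val (is_diff_def := iU)).
move: (dU (pt 1 0)) (dV (pt 1 0)) LU LV => a b LU LV {J1 J2 J dU dV iU iV}.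
have K0 : 0 <= K := le_trans (normr_ge0 _) (UK 0).
apply/eqP; rewrite -normr_le0; apply/ler_addgt0Pl => e e0; rewrite addr0.
have e8 : 0 < e / 8 by rewrite divr_gt0.
have [ru ru0 Bu] := LU _ e8; have [rv rv0 Bv] := LV _ e8.
pose r := Num.min ru rv; have r0 : 0 < r by rewrite lt_min ru0.
have rru : r <= ru by rewrite ge_min lexx.
have rrv : r <= rv by rewrite ge_min lexx orbT.
(* x1 is so far left that f is almost affine on the disc of radius e^x1; x2 is
   so far right that e^(-x2) beats the bound on f. *)
pose x1 := ln r; have x1E : expR x1 = r by rewrite lnK.
pose x2 := Num.max x1 (8 * K / e).
have x12 : x1 <= x2 by rewrite le_max lexx.
have x2K : 4 * K * expR (- x2) <= e / 2.
  have : 8 * K / e <= expR x2.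
    apply: (@le_trans _ _ x2); first by rewrite le_max lexx orbT.
    by apply: le_trans (expR_ge1Dx x2); rewrite lerDr.
  rewrite (ler_pdivrMr _ _ e0) expRN => le8.
  by rewrite ler_pdivrMr ?expR_gt0 //; move: le8; move: (expR x2) => E; clear; lra.
have SE x y : S (pt x y) = expR (- x) * (cos y * (U (h (pt x y)) - U p) + sin y * (V (h (pt x y)) - V p)).
  by rewrite /S /re /im lsubmx_pt rsubmx_pt cosN sinN; ring.
have TE x y : T (pt x y) = expR (- x) * (cos y * (V (h (pt x y)) - V p) - sin y * (U (h (pt x y)) - U p)).
  by rewrite /T /re /im lsubmx_pt rsubmx_pt cosN sinN; ring.
have ptT x y : T (pt x (y + pi *+ 2)) = T (pt x y).
  by rewrite !TE !hE cosD2pi sinD2pi.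
have cs_le1 y (u v k : R) : `|u| <= k -> `|v| <= k -> `|cos y * u + sin y * v| <= 2 * k.
  move=> uk vk; apply: le_trans (ler_normD _ _) _; rewrite !normrM.
  have c1 := cos_max y; have s1 : `|sin y| <= 1 by rewrite ler_norml sin_geN1 sin_le1.
  have h1 := ler_pM (normr_ge0 _) (normr_ge0 _) c1 uk.
  by have h2 := ler_pM (normr_ge0 _) (normr_ge0 _) s1 vk; lra.
have near1 y : `|S (pt x1 y) - a| <= e / 2.
  rewrite SE hE.
  set h1 := expR x1 * cos y; set h2 := expR x1 * sin y.
  have n1 : `|h1| <= r by rewrite normrM x1E gtr0_norm // ler_piMr ?cos_max // ltW.
  have n2 : `|h2| <= r.
    rewrite normrM x1E gtr0_norm // ler_piMr ?(ltW r0) //.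
    by rewrite ler_norml sin_geN1 sin_le1.
  have := Bu (px + h1) (py + h2); have := Bv (px + h1) (py + h2).
  rewrite ![_ + h1 - _]addrAC ![_ + h2 - _]addrAC !subrr !add0r.
  move=> /(_ (le_trans n1 rrv) (le_trans n2 rrv)) bv /(_ (le_trans n1 rru) (le_trans n2 rru)) bu.
  have e2r : e / 8 * (`|h1| + `|h2|) <= e / 4 * r.
    have -> : e / 4 * r = e / 8 * (2 * r) by field.
    by rewrite ler_pM2l //; move: n1 n2; clear; lra.
  have := cs_le1 y _ _ _ (le_trans bu e2r) (le_trans bv e2r).
  rewrite -/p.
  set u := U _ - U p; set v := V _ - V p => bb.
  have E1 : expR (- x1) * expR x1 = 1 by rewrite -expRD addNr expR0.
  have cs1 : cos y * cos y + sin y * sin y = 1 by rewrite -!expr2 cos2Dsin2.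
  have -> : expR (- x1) * (cos y * u + sin y * v) - a = expR (- x1) *
     (cos y * (u - a * h1 - - b * h2) + sin y * (v - b * h1 - a * h2)).
    have aE : a = (expR (- x1) * expR x1) * (cos y * cos y + sin y * sin y) * a by rewrite E1 cs1 !mul1r.
    by rewrite {1}aE /h1 /h2; ring.
  rewrite normrM gtr0_norm ?expR_gt0 // expRN x1E ler_pdivrMl //.
  by apply: le_trans bb _; rewrite mulrC; lra.
have far y : `|S (pt x2 y) - 0| <= e / 2.
  rewrite subr0 SE normrM gtr0_norm ?expR_gt0 //.
  have U2 : `|U (h (pt x2 y)) - U p| <= 2 * K.
    by apply: le_trans (ler_normB _ _) _; have := UK (h (pt x2 y)); have := UK p; lra.
  have V2 : `|V (h (pt x2 y)) - V p| <= 2 * K.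
    by apply: le_trans (ler_normB _ _) _; have := VK (h (pt x2 y)); have := VK p; lra.
  apply: le_trans x2K; rewrite mulrC ler_pM2r ?expR_gt0 //.
  by apply: le_trans (cs_le1 _ _ _ _ U2 V2) _; lra.
have contS w : {for w, continuous S}.
  by have [? [? [i _ _]]] := cr_ST w; apply: differentiable_continuous; exact: ex_diff.
have contT w : {for w, continuous T}.
  by have [? [? [_ i _]]] := cr_ST w; apply: differentiable_continuous; exact: ex_diff.
have contx y : continuous (pt^~ y).
  move=> x; apply: differentiable_continuous.
  have := is_diffD (is_diff_scalel x (pt 1 0)) (is_diff_cst (pt 0 y) x).
  rewrite (_ : _ + _ = pt^~ y) => [?|]; first exact: ex_diff.
  apply/funext => t; rewrite !fctE /pt scale_row_mx add_row_mx !scale_scalar_mx mulr1 mulr0.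
  by rewrite !raddf0 addr0 add0r.
have conty x : continuous (pt x).
  move=> y; apply: differentiable_continuous.
  have := is_diffD (is_diff_scalel y (pt 0 1)) (is_diff_cst (pt x 0) y).
  rewrite (_ : _ + _ = pt x) => [?|]; first exact: ex_diff.
  apply/funext => t; rewrite !fctE /pt scale_row_mx add_row_mx !scale_scalar_mx mulr1 mulr0.
  by rewrite !raddf0 addr0 add0r.
have pi2 : 0 < (pi : R) *+ 2 by rewrite mulrn_wgt0 // pi_gt0.
have := closed_form_mean closed _ _ pi2 ptT x12 near1 far.
rewrite subr0 -splitr; apply.
- by move=> y x; apply: (@continuous_comp _ _ _ (pt^~ y) T x); [exact: contx|exact: contT].
- by move=> x y; apply: (@continuous_comp _ _ _ (pt x) S y); [exact: conty|exact: contS].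
Qed.

Lemma Liouville_one_variable (U V : 'rV[R]_(1 + 1) -> R) K :
  (forall q, cauchy_riemann U V q) ->
  (forall q, `|U q| <= K) -> (forall q, `|V q| <= K) -> forall p q, U p = U q.
Proof.
move=> cr UK VK; apply: diff0_cst => p.
have U0 := bounded_entire_diff p cr UK VK.
have V0 : 'd V p (pt 1 0) = 0.
  apply: (@bounded_entire_diff V (fun q => - U q) K) => // q; last by rewrite normrN.
  exact: cauchy_riemann_rot.
have [dU [dV [iU iV J]]] := cr p.
rewrite (diff_val (is_diff_def := iU)) in U0.
rewrite (diff_val (is_diff_def := iV)) in V0.
have [J1 _] := J (pt 1 0); rewrite pt_mulJ oppr0 V0 oppr0 in J1.
split; first exact: ex_diff.
apply/funext => w; rewrite (pt_coord w).
have -> : pt (lsubmx w 0 0) (rsubmx w 0 0) =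
   lsubmx w 0 0 *: pt 1 0 + rsubmx w 0 0 *: pt 0 1.
  rewrite /pt !scale_row_mx add_row_mx !scale_scalar_mx !mulr1 !mulr0.
  by rewrite !raddf0 addr0 add0r.
by rewrite linearD !linearZ /= (diff_val (is_diff_def := iU)) U0 J1 !scaler0 addr0.
Qed.

(** Restrict to the complex line through [p] and [q]. *)
Lemma Liouville n (U V : 'rV[R]_(n + n) -> R) K :
  (forall q, cauchy_riemann U V q) ->
  (forall q, `|U q| <= K) -> (forall q, `|V q| <= K) -> forall p q, U p = U q.
Proof.
move=> cr UK VK p q.
pose h (w : 'rV[R]_(1 + 1)) := p + (lsubmx w 0 0 *: (q - p) + rsubmx w 0 0 *: ((q - p) *m Jmx R n)).
have hcr w : cauchy_riemann (fun w => U (h w)) (fun w => V (h w)) w.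
  by apply: cauchy_riemann_comp; [exact: cauchy_riemann_coord|exact: cr].
have := @Liouville_one_variable _ _ K hcr (fun w => UK _) (fun w => VK _) (pt 0 0) (pt 1 0).
rewrite /h !lsubmx_pt !rsubmx_pt !scale0r scale1r !addr0.
by rewrite addrC subrK.
Qed.

(** The left half-plane is mapped into the unit disc by f |-> 1 / (1 - f), to which
    the bounded case applies. *)
Lemma Liouville_half_plane n (U V : 'rV[R]_(n + n) -> R) :
  (forall q, cauchy_riemann U V q) -> (forall q, U q < 0) ->
  forall p q, U p = U q /\ V p = V q.
Proof.
move=> cr Uneg.
pose A q := 1 + - U q; pose B q := 0 + - V q.
have crAB q : cauchy_riemann A B q.
  apply: cauchy_riemannD; first exact: cauchy_riemann_cst.
  by apply: cauchy_riemann_rot; apply: cauchy_riemann_rot.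
have A1 q : 1 < A q by rewrite /A ltrDl oppr_gt0.
have N1 q : 1 <= A q ^+ 2 + B q ^+ 2.
  by have := A1 q; have := sqr_ge0 (B q); nra.
have N0 q : A q ^+ 2 + B q ^+ 2 != 0 by rewrite gt_eqF // (lt_le_trans ltr01).
have crI q := cauchy_riemannV (N0 q) (crAB q).
set U' := (fun q => _) in crI; set V' := (fun q => - _ * _) in crI.
have bnd (c : R) q : `|c| <= A q ^+ 2 + B q ^+ 2 -> `|c * (A q ^+ 2 + B q ^+ 2)^-1| <= 1.
  move=> cN; rewrite normrM normfV (ger0_norm (le_trans ler01 (N1 q))).
  by rewrite ler_pdivrMr ?mul1r // (lt_le_trans ltr01).
have sq (c d : R) : 1 <= c ^+ 2 + d ^+ 2 -> `|c| <= c ^+ 2 + d ^+ 2.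
  move=> cd; have := sqr_ge0 d; have := sqr_ge0 (`|c| - 1); rewrite sqrrB1 real_normK ?num_real //.
  by move: (normr_ge0 c) => ? ?; have [|] := lerP `|c| 1; nra.
have U1 q : `|U' q| <= 1 by apply: bnd; exact: sq.
have V1 q : `|V' q| <= 1 by apply: bnd; rewrite normrN addrC; apply: sq; rewrite addrC.
have Uc := Liouville crI U1 V1.
have Vc : forall p q, V' p = V' q.
  apply: (@Liouville _ V' (fun q => - U' q) 1) => // q; last by rewrite normrN.
  exact: cauchy_riemann_rot.
have inv q : A q = U' q * (U' q ^+ 2 + V' q ^+ 2)^-1 /\ B q = - V' q * (U' q ^+ 2 + V' q ^+ 2)^-1.
  rewrite /U' /V'; have := N0 q; move: (A q) (B q) => a b ab0.
  have E : (a * (a ^+ 2 + b ^+ 2)^-1) ^+ 2 + (- b * (a ^+ 2 + b ^+ 2)^-1) ^+ 2 = (a ^+ 2 + b ^+ 2)^-1.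
    by field.
  by rewrite E invrK !mulNr opprK -!mulrA mulVf // !mulr1.
move=> p q; have [Ap Bp] := inv p; have [Aq Bq] := inv q.
have AE : A p = A q by rewrite Ap Aq (Uc p q) (Vc p q).
have BE : B p = B q by rewrite Bp Bq (Uc p q) (Vc p q).
by move: AE BE; rewrite /A /B => /addrI/oppr_inj -> /addrI/oppr_inj ->.
Qed.

End Liouville.

(** * The tangent bundle is not the complex plane squared *)

Lemma not_biholomorphic_plane (R : realType) :
  ~ biholomorphic (tangent_bundle (half_plane R))
      ([set: 'rV[R]_(2 + 2)] : set 'rV[R]_(2 + 2)).
Proof.
move=> [F [G [FG GF _ holG]]].
have neg q : lsubmx (G q) 0 1 < 0 by have [] := GF q I.
have cst12 := Liouville_half_plane
  (fun q => holomorphic_cr 1 holG (I : [set: 'rV[R]_(2 + 2)] q)) neg.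
have GE (c : R) : c < 0 -> exists q, lsubmx (G q) 0 1 = c.
  move=> c0; exists (F (const_mx c)).
  have [|_ ->] := FG (const_mx c); last by rewrite !mxE.
  by rewrite /tangent_bundle /half_plane /= !mxE.
have [q1 e1] : exists q, lsubmx (G q) 0 1 = -1 by apply: GE; rewrite ltrN10.
have [q2 e2] : exists q, lsubmx (G q) 0 1 = -2 by apply: GE; rewrite oppr_lt0.
have [] := cst12 q1 q2; rewrite e1 e2 => /oppr_inj/eqP.
by rewrite -subr_eq0 => /eqP h _; lra.
Qed.

(** * Gradients of functions of two variables *)

Lemma ord2_ind (P : 'I_2 -> Prop) : P 0 -> P 1 -> forall j, P j.
Proof.
move=> P0 P1 [[|[|//]] h].
- by rewrite (_ : Ordinal h = 0) //; exact: val_inj.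
- by rewrite (_ : Ordinal h = 1) //; exact: val_inj.
Qed.

Section Gradient.
Variable R : realType.

Definition gradient (f : 'rV[R]_2 -> R) (u : 'rV[R]_2) (a b : R) : Prop :=
  is_diff u f (fun w => a * w 0 0 + b * w 0 1).

Lemma gradient_eq f u a b a' b' : gradient f u a b -> a = a' -> b = b' ->
  gradient f u a' b'.
Proof. by move=> + <- <-. Qed.

Lemma gradient_diff f u df : is_diff u f df ->
  gradient f u (df (delta_mx 0 0)) (df (delta_mx 0 1)).
Proof.
move=> [dif <-]; split => //; apply/funext => w.
have {1}-> : w = w 0 0 *: delta_mx 0 0 + w 0 1 *: delta_mx 0 1.
  by apply/rowP; apply: ord2_ind; rewrite !mxE /=; ring.
by rewrite linearD !linearZ /= /GRing.scale /= ![_ * w _ _]mulrC.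
Qed.

Lemma gradient_cst c u : gradient (fun=> c) u 0 0.
Proof.
by apply: gradient_eq (gradient_diff (is_diff_cst c u)) _ _.
Qed.

Lemma gradient_coord j u :
  gradient (fun u => u 0 j) u (j == 0)%:R (j == 1)%:R.
Proof.
have h : is_diff u (fun u : 'rV[R]_2 => u 0 j) (fun u => u 0 j).
  apply: diff_coord; first by move=> a v w; rewrite !mxE.
  exact: coord_continuous.
by apply: gradient_eq (gradient_diff h) _ _; rewrite !mxE eqxx.
Qed.

Lemma gradientD f g u a b a' b' : gradient f u a b -> gradient g u a' b' ->
  gradient (fun u => f u + g u) u (a + a') (b + b').
Proof.
move=> hf hg; apply: gradient_eq (gradient_diff (is_diffD hf hg)) _ _;
by rewrite !fctE !mxE /=; ring.
Qed.

Lemma gradientN f u a b : gradient f u a b ->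
  gradient (fun u => - f u) u (- a) (- b).
Proof.
move=> hf; apply: gradient_eq (gradient_diff (is_diffN hf)) _ _;
by rewrite !fctE !mxE /=; ring.
Qed.

Lemma gradientM f g u a b a' b' : gradient f u a b -> gradient g u a' b' ->
  gradient (fun u => f u * g u) u (f u * a' + g u * a) (f u * b' + g u * b).
Proof.
move=> hf hg; apply: gradient_eq (gradient_diff (is_diffM hf hg)) _ _;
by rewrite !fctE /GRing.scale /= !mxE /=; ring.
Qed.

Lemma gradient_comp f (h : R -> R) u a b d : gradient f u a b ->
  is_derive (f u) 1 h d -> gradient (fun u => h (f u)) u (d * a) (d * b).
Proof.
move=> hf hh.
apply: gradient_eq (gradient_diff (is_diff_comp hf (is_derive_is_diff hh))) _ _;
by rewrite /= !mxE /=; ring.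
Qed.

Lemma gradient_partial f u a b : gradient f u a b ->
  partial 0 f u = a /\ partial 1 f u = b.
Proof.
move=> hf; have df : differentiable f u := ex_diff (is_diff_def := hf).
rewrite /partial !deriveE //.
by rewrite (diff_val (is_diff_def := hf)) !mxE /=; split; ring.
Qed.

Lemma open_half_plane : open (half_plane R).
Proof.
have -> : half_plane R = (fun u : 'rV[R]_2 => u 0 1) @^-1` [set y | y < 0] by [].
by apply: open_comp; [move=> u _; exact: coord_continuous|exact: open_lt].
Qed.

Lemma near_half_plane (P : 'rV[R]_2 -> Prop) u : half_plane R u ->
  (forall v, half_plane R v -> P v) -> \forall v \near u, P v.
Proof.
move=> Hu HP; have : \forall v \near u, half_plane R v by exact: open_nbhs_nbhs (conj open_half_plane Hu).
by apply: filterS.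
Qed.

Lemma partial_eq (f g : 'rV[R]_2 -> R) i u : half_plane R u ->
  (forall v, half_plane R v -> f v = g v) -> partial i f u = partial i g u.
Proof.
by move=> Hu fg; apply: near_eq_derive; exact: near_half_plane.
Qed.

End Gradient.

(** * Curvature of a Sasaki metric *)

Section SasakiCurvature.
Variables (R : realType) (n : nat) (Psi : 'rV[R]_n -> R).
Let g := hessian Psi.

Lemma derive_lsubmx (f : 'rV[R]_n -> R) (w p : 'rV[R]_(n + n)) :
  'D_w (fun q => f (lsubmx q)) p = 'D_(lsubmx w) f (lsubmx p).
Proof.
have E : (fun h : R => h^-1 *: (((fun q => f (lsubmx q)) \o shift p) (h *: w) - f (lsubmx p)))
    = (fun h : R => h^-1 *: ((f \o shift (lsubmx p)) (h *: lsubmx w) - f (lsubmx p))).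
  by apply/funext => h /=; rewrite linearP.
by rewrite /derive E.
Qed.

Lemma partial_lshift (f : 'rV[R]_n -> R) (i : 'I_n) (p : 'rV[R]_(n + n)) :
  partial (lshift n i) (fun q => f (lsubmx q)) p = partial i f (lsubmx p).
Proof.
rewrite /partial derive_lsubmx (_ : lsubmx (delta_mx _ _) = delta_mx 0 i) //.
by apply/rowP => j; rewrite !mxE eq_lshift.
Qed.

Lemma partial_rshift (f : 'rV[R]_n -> R) (i : 'I_n) (p : 'rV[R]_(n + n)) :
  partial (rshift n i) (fun q => f (lsubmx q)) p = 0.
Proof.
rewrite /partial derive_lsubmx (_ : lsubmx (delta_mx _ _) = 0) ?derive0 //.
by apply/rowP => j; rewrite !mxE eq_lrshift andbF.
Qed.

Lemma sasaki_ll i j : (fun q => sasaki Psi q (lshift n i) (lshift n j)) =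
  (fun q => g (lsubmx q) i j).
Proof. by apply/funext => q; rewrite /sasaki block_mxEul. Qed.

Lemma sasaki_lr i j : (fun q => sasaki Psi q (lshift n i) (rshift n j)) = (fun=> 0).
Proof. by apply/funext => q; rewrite /sasaki block_mxEur mxE. Qed.

Lemma sasaki_rl i j : (fun q => sasaki Psi q (rshift n i) (lshift n j)) = (fun=> 0).
Proof. by apply/funext => q; rewrite /sasaki block_mxEdl mxE. Qed.

Lemma sasaki_rr i j : (fun q => sasaki Psi q (rshift n i) (rshift n j)) =
  (fun q => g (lsubmx q) i j).
Proof. by apply/funext => q; rewrite /sasaki block_mxEdr. Qed.

Lemma partial_cst i (c : R) (p : 'rV[R]_(n + n)) : partial i (fun=> c) p = 0.
Proof. exact: derive_cst. Qed.

Lemma partial_sasaki_diag (k i j : 'I_n) (p : 'rV[R]_(n + n)) :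
  (partial (lshift n k) (fun q => sasaki Psi q (lshift n i) (lshift n j)) p =
     partial k (fun v => g v i j) (lsubmx p)) *
  (partial (lshift n k) (fun q => sasaki Psi q (rshift n i) (rshift n j)) p =
     partial k (fun v => g v i j) (lsubmx p)) *
  (partial (rshift n k) (fun q => sasaki Psi q (lshift n i) (lshift n j)) p = 0) *
  (partial (rshift n k) (fun q => sasaki Psi q (rshift n i) (rshift n j)) p = 0).
Proof.
rewrite sasaki_ll sasaki_rr !(partial_lshift (fun v => g v i j)).
by rewrite !(partial_rshift (fun v => g v i j)).
Qed.

Lemma partial_sasaki_off (k : 'I_(n + n)) (i j : 'I_n) (p : 'rV[R]_(n + n)) :
  (partial k (fun q => sasaki Psi q (lshift n i) (rshift n j)) p = 0) *
  (partial k (fun q => sasaki Psi q (rshift n i) (lshift n j)) p = 0).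
Proof. by rewrite sasaki_lr sasaki_rl !partial_cst. Qed.

Lemma invmx_sasaki p : g (lsubmx p) \in unitmx ->
  invmx (sasaki Psi p) = block_mx (invmx (g (lsubmx p))) 0 0 (invmx (g (lsubmx p))).
Proof.
move=> gU; have E : sasaki Psi p *m
    block_mx (invmx (g (lsubmx p))) 0 0 (invmx (g (lsubmx p))) = 1%:M.
  rewrite /sasaki mulmx_block !mul0mx !mulmx0 !addr0 !add0r mulmxV //.
  by rewrite -scalar_mx_block.
by have [sU _] := mulmx1_unit E; rewrite -[RHS]mul1mx -(mulVmx sU) -mulmxA E mulmx1.
Qed.

(** The Hessian is invertible and the third derivatives of the potential are
    symmetric.  Symmetry is a hypothesis at a point, to be checked on the explicit
    potential. *)
Definition hessian_regular (u : 'rV[R]_n) : Prop :=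
  g u \in unitmx /\ forall i j l,
    partial i (fun v => g v j l) u = partial j (fun v => g v i l) u /\
    partial i (fun v => g v j l) u = partial i (fun v => g v l j) u.

(** In a Sasaki metric the Gram matrix is block diagonal with equal blocks and
    depends on u only.  Hence a Christoffel symbol with an odd number of v-indices
    vanishes, and the others agree with those of the base up to sign; below l and r
    stand for u- and v-indices. *)
Section Blocks.
Variable p : 'rV[R]_(n + n).
Hypothesis symp : hessian_regular (lsubmx p).
Let c k i j := christoffel g k i j (lsubmx p).

Let cE k i j : c k i j =
  2^-1 * \sum_l invmx (g (lsubmx p)) k l * partial i (fun v => g v j l) (lsubmx p).
Proof.
rewrite /c /christoffel; congr (_ * _); apply: eq_bigr => l _; congr (_ * _).
have [_ s] := symp; rewrite (s j i l).1 (s l i j).1 (s i l j).2.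
by rewrite addrK.
Qed.

Let partialE := (partial_sasaki_diag, partial_sasaki_off).

Let gU : g (lsubmx p) \in unitmx. Proof. by case: symp. Qed.

Let suml k (F : 'I_(n + n) -> R) :
  \sum_l invmx (sasaki Psi p) (lshift n k) l * F l =
  \sum_l invmx (g (lsubmx p)) k l * F (lshift n l).
Proof.
rewrite invmx_sasaki // big_split_ord /= [X in _ + X]big1 ?addr0 => [|l _].
  by apply: eq_bigr => l _; rewrite block_mxEul.
by rewrite block_mxEur mxE mul0r.
Qed.

Let sumr k (F : 'I_(n + n) -> R) :
  \sum_l invmx (sasaki Psi p) (rshift n k) l * F l =
  \sum_l invmx (g (lsubmx p)) k l * F (rshift n l).
Proof.
rewrite invmx_sasaki // big_split_ord /= [X in X + _]big1 ?add0r => [|l _].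
  by apply: eq_bigr => l _; rewrite block_mxEdr.
by rewrite block_mxEdl mxE mul0r.
Qed.

Lemma christoffel_lll k i j :
  christoffel (sasaki Psi) (lshift n k) (lshift n i) (lshift n j) p = c k i j.
Proof.
rewrite /christoffel suml /c /christoffel; congr (_ * _); apply: eq_bigr => l _.
by rewrite !partialE.
Qed.

Lemma christoffel_rlr k i j :
  christoffel (sasaki Psi) (rshift n k) (lshift n i) (rshift n j) p = c k i j.
Proof.
rewrite /christoffel sumr cE; congr (_ * _); apply: eq_bigr => l _.
by rewrite !partialE subr0 addr0.
Qed.

Lemma christoffel_lrr k i j :
  christoffel (sasaki Psi) (lshift n k) (rshift n i) (rshift n j) p = - c k i j.
Proof.
rewrite /christoffel suml cE -mulrN -sumrN; congr (_ * _); apply: eq_bigr => l _.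
rewrite !partialE addr0 sub0r mulrN; congr (- (_ * _)).
by have [_ s] := symp; rewrite (s l i j).1 (s i l j).2.
Qed.

Lemma christoffel_llr k i j :
  christoffel (sasaki Psi) (lshift n k) (lshift n i) (rshift n j) p = 0.
Proof.
rewrite /christoffel suml big1 ?mulr0 // => l _.
by rewrite !partialE subr0 addr0 mulr0.
Qed.

Lemma christoffel_lrl k i j :
  christoffel (sasaki Psi) (lshift n k) (rshift n i) (lshift n j) p = 0.
Proof.
rewrite /christoffel suml big1 ?mulr0 // => l _.
by rewrite !partialE subr0 addr0 mulr0.
Qed.
End Blocks.

Variable O : set 'rV[R]_n.
Hypotheses (Oopen : open O) (Osym : forall u, O u -> hessian_regular u).

Lemma near_lsubmx (P : 'rV[R]_(n + n) -> Prop) p : O (lsubmx p) ->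
  (forall q, O (lsubmx q) -> P q) -> \forall q \near p, P q.
Proof.
move=> Op HP; have : \forall q \near p, O (lsubmx q).
  by apply: continuous_lsubmx; exact: open_nbhs_nbhs (conj Oopen Op).
by apply: filterS.
Qed.

(** The coefficient of the u_m direction in R(u_i, v_j) v_l, in terms of the
    Christoffel symbols of the base. *)
Definition mixed_curvature_up m i j l u : R :=
  partial i (fun v => - christoffel g m j l v) u
  + \sum_r (christoffel g m j r u * christoffel g r i l u
            - christoffel g m i r u * christoffel g r j l u).

Lemma curvature_up_llll m i j l p : O (lsubmx p) ->
  curvature_up (sasaki Psi) (lshift n m) (lshift n i) (lshift n j) (lshift n l) p =
  curvature_up g m i j l (lsubmx p).
Proof.
move=> Op; have sp := Osym Op; rewrite /curvature_up; congr (_ + _).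
  have chris k a b : partial (lshift n k) (christoffel (sasaki Psi) (lshift n m) (lshift n a) (lshift n b)) p
      = partial k (christoffel g m a b) (lsubmx p).
    rewrite -partial_lshift; apply: near_eq_derive; apply: near_lsubmx => // q /Osym sq.
    exact: christoffel_lll.
  by rewrite !chris.
rewrite big_split_ord /= [X in _ + X]big1 ?addr0 => [|r _].
  by apply: eq_bigr => r _; rewrite !christoffel_lll.
by rewrite !christoffel_llr // !mul0r subrr.
Qed.

Lemma curvature_up_llrr m i j l p : O (lsubmx p) ->
  curvature_up (sasaki Psi) (lshift n m) (lshift n i) (rshift n j) (rshift n l) p =
  mixed_curvature_up m i j l (lsubmx p).
Proof.
move=> Op; have sp := Osym Op; rewrite /curvature_up; congr (_ + _).
  rewrite -[LHS]/(_ - _) [X in _ - X](_ : _ = 0) ?subr0.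
    rewrite -(partial_lshift (fun v => - christoffel g m j l v)).
    apply: near_eq_derive; apply: near_lsubmx => // q /Osym sq.
    by rewrite christoffel_lrr.
  rewrite -(partial_cst (rshift n j) 0 p); apply: near_eq_derive.
  by apply: near_lsubmx => // q /Osym sq; rewrite christoffel_llr.
rewrite big_split_ord /= addrC -big_split /=; apply: eq_bigr => r _.
rewrite christoffel_llr // christoffel_rlr // !christoffel_lrr // !christoffel_lll //.
by rewrite christoffel_lrl //; ring.
Qed.

Lemma anti_bisectionalE p (eta xi : 'rV[R]_n) : O (lsubmx p) ->
  anti_bisectional Psi p eta xi =
  \sum_i \sum_j \sum_k \sum_l xi 0 i * eta 0 j * xi 0 k * eta 0 l *
    (\sum_m g (lsubmx p) k m * mixed_curvature_up m i j l (lsubmx p))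
  - Riem g (lsubmx p) eta xi eta xi.
Proof.
move=> Op; rewrite /anti_bisectional.
have re_l (w : 'rV[R]_n) i : real_vector w 0 (lshift n i) = w 0 i by rewrite row_mxEl.
have re_r (w : 'rV[R]_n) i : real_vector w 0 (rshift n i) = 0 by rewrite row_mxEr mxE.
have im_l (w : 'rV[R]_n) i : (real_vector w *m Jmx R n) 0 (lshift n i) = 0.
  have -> : (real_vector w *m Jmx R n) 0 (lshift n i) = lsubmx (real_vector w *m Jmx R n) 0 i by rewrite [RHS]mxE.
  by rewrite lsubmxJ row_mxKr !mxE oppr0.
have im_r (w : 'rV[R]_n) i : (real_vector w *m Jmx R n) 0 (rshift n i) = w 0 i.
  have -> : (real_vector w *m Jmx R n) 0 (rshift n i) = rsubmx (real_vector w *m Jmx R n) 0 i by rewrite [RHS]mxE.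
  by rewrite rsubmxJ row_mxKl.
have suml0 (F : 'I_(n + n) -> R) : (forall i, F (rshift n i) = 0) -> \sum_i F i = \sum_i F (lshift n i).
  by move=> F0; rewrite big_split_ord /= [X in _ + X]big1 ?addr0.
have sumr0 (F : 'I_(n + n) -> R) : (forall i, F (lshift n i) = 0) -> \sum_i F i = \sum_i F (rshift n i).
  by move=> F0; rewrite big_split_ord /= [X in X + _]big1 ?add0r.
congr (_ - _); rewrite /Riem.
  rewrite suml0 => [|i]; last first.
    by rewrite re_r; do 3 (apply: big1 => ? _); rewrite !mul0r.
  apply: eq_bigr => i _; rewrite sumr0 => [|j]; last first.
    by rewrite im_l; do 2 (apply: big1 => ? _); rewrite mulr0 !mul0r.
  apply: eq_bigr => j _; rewrite suml0 => [|k]; last first.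
    by rewrite re_r; apply: big1 => ? _; rewrite mulr0 !mul0r.
  apply: eq_bigr => k _; rewrite sumr0 => [|l]; last by rewrite im_l mulr0 mul0r.
  apply: eq_bigr => l _; rewrite !re_l !im_r; congr (_ * _).
  rewrite suml0 => [|m]; last by rewrite /sasaki block_mxEur mxE mul0r.
  by apply: eq_bigr => m _; rewrite curvature_up_llrr // /sasaki block_mxEul.
rewrite suml0 => [|i]; last first.
  by rewrite re_r; do 3 (apply: big1 => ? _); rewrite !mul0r.
apply: eq_bigr => i _; rewrite suml0 => [|j]; last first.
  by rewrite re_r; do 2 (apply: big1 => ? _); rewrite mulr0 !mul0r.
apply: eq_bigr => j _; rewrite suml0 => [|k]; last first.
  by rewrite re_r; apply: big1 => ? _; rewrite mulr0 !mul0r.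
apply: eq_bigr => k _; rewrite suml0 => [|l]; last by rewrite re_r mulr0 mul0r.
apply: eq_bigr => l _; rewrite !re_l; congr (_ * _).
rewrite suml0 => [|m]; last by rewrite /sasaki block_mxEur mxE mul0r.
by apply: eq_bigr => m _; rewrite curvature_up_llll // /sasaki block_mxEul.
Qed.

End SasakiCurvature.

(** * The potential, its metric and its Christoffel symbols *)

(** Symmetric 2 x 2 tables; [T] may itself be a type of tables. *)
Definition sym2 (T : Type) (a b c : T) (i j : 'I_2) : T :=
  if i == 0 then if j == 0 then a else b else if j == 0 then b else c.

Section Potential.
Variable R : realType.
Implicit Types u : 'rV[R]_2.

(** All derivatives of the potential of order at least two and all Christoffel
    symbols are sums of such Laurent monomials, and this class is stable under
    differentiation ([gradient_monomial]). *)
Definition monomial (c : R) (m k : nat) u : R := c * u 0 0 ^+ m * u 0 1 ^- k.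

Definition potential_metric u : 'I_2 -> 'I_2 -> R :=
  sym2 (monomial (- 2^-1) 0 1 u) (monomial 2^-1 1 2 u)
    (monomial (- 2^-1) 2 3 u + monomial 2^-1 0 2 u).

Definition potential_third u (i : 'I_2) : 'I_2 -> 'I_2 -> R :=
  if i == 0 then
    sym2 0 (monomial 2^-1 0 2 u) (monomial (- 1) 1 3 u)
  else
    sym2 (monomial 2^-1 0 2 u) (monomial (- 1) 1 3 u)
      (monomial (3 / 2) 2 4 u + monomial (- 1) 0 3 u).

Definition potential_christoffel u (k : 'I_2) : 'I_2 -> 'I_2 -> R :=
  if k == 0 then
    sym2 (monomial 2^-1 1 1 u) (monomial (- 2^-1) 2 2 u + monomial (- 2^-1) 0 1 u)
      (monomial 2^-1 3 3 u)
  else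
    sym2 (monomial 2^-1 0 0 u) (monomial (- 2^-1) 1 1 u)
      (monomial 2^-1 2 2 u + monomial (- 1) 0 1 u).

Lemma half_plane_neq0 u : half_plane R u -> u 0 1 != 0.
Proof. by move=> Hu; rewrite lt_eqF. Qed.

Lemma gradient_monomial c m k u : half_plane R u ->
  gradient (monomial c m k) u (monomial (c * m%:R) m.-1 k u)
    (monomial (- (c * k%:R)) m k.+1 u).
Proof.
move=> Hu; have y0 := half_plane_neq0 Hu.
have dX n (t : R) : is_derive t 1 (fun t => t ^+ n) (n%:R * t ^+ n.-1).
  have h := DeriveDef (@exprn_derivable R n t 1) (@exp_derive R n t 1).
  by apply: is_derive_eq h _; rewrite /GRing.scale /= mulr1.
have dY : is_derive (u 0 1) 1 (fun t => t ^- k) (- k%:R * u 0 1 ^- k.+1).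
  have yk0 : u 0 1 ^+ k != 0 by rewrite expf_neq0.
  have h := is_deriveV (f := fun t => t ^+ k) yk0 (dX k (u 0 1)).
  apply: is_derive_eq h _; rewrite /GRing.scale /=; case: k {yk0} => [|k] /=.
    by rewrite oppr0 !mul0r mulr0.
  have E : u 0 1 ^+ k.+2 = u 0 1 ^+ k * u 0 1 ^+ 2 by rewrite -exprD addn2.
  have yk0 : u 0 1 ^+ k != 0 by rewrite expf_neq0.
  by rewrite E (exprSr _ k); move: (u 0 1 ^+ k) yk0 => w w0; field; rewrite w0 y0.
have h := gradientM (gradientM (gradient_cst c u)
  (gradient_comp (gradient_coord 0 u) (dX m _)))
  (gradient_comp (gradient_coord 1 u) dY).
by apply: gradient_eq h _ _; rewrite /monomial /=; ring.
Qed.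

Lemma gradient_monomialD c m k c' m' k' u : half_plane R u ->
  gradient (fun v => monomial c m k v + monomial c' m' k' v) u
    (monomial (c * m%:R) m.-1 k u + monomial (c' * m'%:R) m'.-1 k' u)
    (monomial (- (c * k%:R)) m k.+1 u + monomial (- (c' * k'%:R)) m' k'.+1 u).
Proof. by move=> Hu; apply: gradientD; exact: gradient_monomial. Qed.

Lemma gradient_potential u : half_plane R u ->
  gradient (potential R) u (monomial (- 2^-1) 1 1 u)
    (monomial 4^-1 2 2 u + monomial (- 2^-1) 0 1 u).
Proof.
move=> Hu; have y0 := half_plane_neq0 Hu.
have y2 : 0 < -2 * u 0 1 by rewrite nmulr_rgt0 // oppr_lt0.
have h := gradientD (gradient_monomial (- 4^-1) 2 1 Hu)
  (gradientN (gradientM (gradient_cst 2^-1 u)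
    (gradient_comp (f := fun v => -2 * v 0 1)
      (gradientM (gradient_cst (-2) u) (gradient_coord 1 u)) (is_derive1_ln y2)))).
have E : potential R = (fun v => monomial (- 4^-1) 2 1 v - 2^-1 * ln (-2 * v 0 1)).
  apply/funext => v; rewrite /potential /monomial; congr (_ + _).
  by rewrite invfM !mulNr expr1; congr (- _); ring.
rewrite E; apply: gradient_eq h _ _; rewrite /monomial /=; field; rewrite ?y0 //.
Qed.

Lemma hessian_potential u : half_plane R u ->
  hessian (potential R) u = \matrix_(i, j) potential_metric u i j.
Proof.
move=> Hu.
have p0 i : partial i (partial 0 (potential R)) u = partial i (monomial (- 2^-1) 1 1) u.
  by apply: partial_eq => // v /gradient_potential/gradient_partial[].
have p1 i : partial i (partial 1 (potential R)) u =
    partial i (fun v => monomial 4^-1 2 2 v + monomial (- 2^-1) 0 1 v) u.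
  by apply: partial_eq => // v /gradient_potential/gradient_partial[].
have [g00 g10] := gradient_partial (gradient_monomial (- 2^-1) 1 1 Hu).
have [g01 g11] := gradient_partial (gradient_monomialD 4^-1 2 2 (- 2^-1) 0 1 Hu).
have y0 := half_plane_neq0 Hu.
have E00 := p0 0; have E10 := p0 1; have E01 := p1 0; have E11 := p1 1.
rewrite g00 in E00; rewrite g10 in E10; rewrite g01 in E01; rewrite g11 in E11.
apply/matrixP; do 2 apply: ord2_ind; rewrite [LHS]mxE [RHS]mxE;
  [rewrite E00 | rewrite E01 | rewrite E10 | rewrite E11];
rewrite /potential_metric /sym2 /= /monomial /=; field; rewrite ?y0 //.
Qed.

Lemma hessian_potentialE u i j : half_plane R u ->
  hessian (potential R) u i j = potential_metric u i j.
Proof. by move=> Hu; rewrite hessian_potential // mxE. Qed.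

Lemma partial_hessian_potential u i j l : half_plane R u ->
  partial i (fun v => hessian (potential R) v j l) u = potential_third u i j l.
Proof.
move=> Hu.
have -> : partial i (fun v => hessian (potential R) v j l) u =
    partial i (fun v => potential_metric v j l) u.
  by apply: partial_eq => // v Hv; exact: hessian_potentialE.
have [g00 g10] := gradient_partial (gradient_monomial (- 2^-1) 0 1 Hu).
have [g01 g11] := gradient_partial (gradient_monomial 2^-1 1 2 Hu).
have [g02 g12] := gradient_partial (gradient_monomialD (- 2^-1) 2 3 2^-1 0 2 Hu).
have y0 := half_plane_neq0 Hu.
move: j l i; do 3 apply: ord2_ind;
rewrite /potential_third /potential_metric /sym2 /= ?g00 ?g10 ?g01 ?g11 ?g02 ?g12 /monomial /=;
field; rewrite ?y0 //.
Qed.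

Definition potential_inverse u : 'I_2 -> 'I_2 -> R :=
  sym2 (2 * u 0 0 ^+ 2 - 2 * u 0 1) (2 * u 0 0 * u 0 1) (2 * u 0 1 ^+ 2).

Lemma hessian_potential_inv u : half_plane R u ->
  hessian (potential R) u \in unitmx /\
  invmx (hessian (potential R) u) = \matrix_(i, j) potential_inverse u i j.
Proof.
move=> Hu; have y0 := half_plane_neq0 Hu.
have E : hessian (potential R) u *m (\matrix_(i, j) potential_inverse u i j) = 1%:M.
  apply/matrixP; do 2 apply: ord2_ind;
  rewrite !mxE !big_ord_recl big_ord0 !hessian_potentialE // !mxE /potential_metric
    /potential_inverse /sym2 /= /monomial; field; rewrite ?y0 //.
have [hU _] := mulmx1_unit E; split => //.
by rewrite -[RHS]mul1mx -(mulVmx hU) -mulmxA E mulmx1.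
Qed.

Lemma hessian_regular_potential u : half_plane R u -> hessian_regular (potential R) u.
Proof.
move=> Hu; split; first by have [] := hessian_potential_inv Hu.
by move=> i j l; rewrite !partial_hessian_potential //; split;
  move: i j l; do 3 apply: ord2_ind.
Qed.

Lemma christoffel_potential u k i j : half_plane R u ->
  christoffel (hessian (potential R)) k i j u = potential_christoffel u k i j.
Proof.
move=> Hu; have y0 := half_plane_neq0 Hu; have [_ hinv] := hessian_potential_inv Hu.
rewrite /christoffel hinv !big_ord_recl big_ord0 !partial_hessian_potential // !mxE.
move: k i j; do 3 apply: ord2_ind;
rewrite /potential_christoffel /potential_inverse /potential_third /sym2 /= /monomial /=;
field; rewrite ?y0 //.
Qed.

End Potential.

(** * Non-negativity of the orthogonal anti-bisectional curvature *)

Section NOABPotential.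
Variable R : realType.
Implicit Types u : 'rV[R]_2.

(** The derivative in the direction u_i of the table [potential_christoffel]. *)
Definition potential_dchristoffel u (i k : 'I_2) : 'I_2 -> 'I_2 -> R :=
  if i == 0 then
    if k == 0 then
      sym2 (monomial 2^-1 0 1 u) (monomial (- 1) 1 2 u) (monomial (3 / 2) 2 3 u)
    else
      sym2 0 (monomial (- 2^-1) 0 1 u) (monomial 1 1 2 u)
  else
    if k == 0 then
      sym2 (monomial (- 2^-1) 1 2 u) (monomial 1 2 3 u + monomial 2^-1 0 2 u)
        (monomial (- (3 / 2)) 3 4 u)
    else
      sym2 0 (monomial 2^-1 1 2 u) (monomial (- 1) 2 3 u + monomial 1 0 2 u).

Lemma gradient_potential_christoffel u k j l : half_plane R u ->
  gradient (fun v => potential_christoffel v k j l) u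
    (potential_dchristoffel u 0 k j l) (potential_dchristoffel u 1 k j l).
Proof.
move=> Hu; have y0 := half_plane_neq0 Hu.
have g1 c m i := gradient_monomial c m i Hu.
have g2 c m i c' m' i' := gradient_monomialD c m i c' m' i' Hu.
move: k j l; do 3 apply: ord2_ind;
  rewrite /potential_christoffel /potential_dchristoffel /sym2 /=;
  (apply: gradient_eq; [first [exact: g1 | exact: g2] | |]);
  by rewrite /monomial /=; field; rewrite ?y0.
Qed.

Lemma partial_christoffel_potential u i k j l : half_plane R u ->
  partial i (christoffel (hessian (potential R)) k j l) u = potential_dchristoffel u i k j l /\
  partial i (fun v => - christoffel (hessian (potential R)) k j l v) u =
    - potential_dchristoffel u i k j l.
Proof.
move=> Hu; have gC := gradient_potential_christoffel k j l Hu.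
have -> : partial i (christoffel (hessian (potential R)) k j l) u =
    partial i (fun v => potential_christoffel v k j l) u.
  by apply: partial_eq => // v Hv; exact: christoffel_potential.
have -> : partial i (fun v => - christoffel (hessian (potential R)) k j l v) u =
    partial i (fun v => - potential_christoffel v k j l) u.
  by apply: partial_eq => // v Hv; rewrite christoffel_potential.
have [p0 p1] := gradient_partial gC; have [n0 n1] := gradient_partial (gradientN gC).
by move: i; apply: ord2_ind; rewrite ?p0 ?p1 ?n0 ?n1.
Qed.

Lemma sum2E (F : 'I_2 -> R) : \sum_i F i = F 0 + F 1.
Proof.
rewrite !big_ord_recl big_ord0 addr0.
by rewrite (_ : lift ord0 ord0 = 1); last exact: val_inj.
Qed.

Lemma lowered_mixed_curvature_potential u i j k l : half_plane R u ->
  \sum_m hessian (potential R) u k m * mixed_curvature_up (potential R) m i j l u =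
  sym2
    (sym2 (monomial 4^-1 0 2 u) (monomial (- 4^-1) 1 3 u)
       (monomial 4^-1 2 4 u + monomial 4^-1 0 3 u))
    (sym2 (monomial (- 4^-1) 1 3 u) (monomial 4^-1 2 4 u + monomial 8^-1 0 3 u)
       (monomial (- 4^-1) 3 5 u + monomial (- 2^-1) 1 4 u))
    (sym2 (monomial 4^-1 2 4 u + monomial 4^-1 0 3 u)
       (monomial (- 4^-1) 3 5 u + monomial (- 2^-1) 1 4 u)
       (monomial 4^-1 4 6 u + monomial 1 2 5 u + monomial (- 2^-1) 0 4 u)) i j k l.
Proof.
move=> Hu; have y0 := half_plane_neq0 Hu.
have pC i' k' j' l' := (partial_christoffel_potential i' k' j' l' Hu).2.
have cC k' i' j' := christoffel_potential k' i' j' Hu.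
rewrite sum2E /mixed_curvature_up !sum2E !pC !cC !(hessian_potentialE _ _ Hu).
move: i j k l; do 4 apply: ord2_ind;
  rewrite /potential_dchristoffel /potential_christoffel /potential_metric /sym2 /= /monomial;
  move: (u 0 0) (u 0 1) y0 => x y y0; field; rewrite ?y0 //.
Qed.

(** The base has constant negative curvature, so its curvature tensor is a multiple
    of the square of the area form. *)
Lemma lowered_curvature_potential u i j k l : half_plane R u ->
  \sum_m hessian (potential R) u k m * curvature_up (hessian (potential R)) m i j l u =
  ((j == 1)%:R - (i == 1)%:R) * ((l == 1)%:R - (k == 1)%:R) * monomial 8^-1 0 3 u.
Proof.
move=> Hu; have y0 := half_plane_neq0 Hu.
have pC i' k' j' l' := (partial_christoffel_potential i' k' j' l' Hu).1.
have cC k' i' j' := christoffel_potential k' i' j' Hu.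
rewrite sum2E /curvature_up !sum2E !pC !cC !(hessian_potentialE _ _ Hu).
move: i j k l; do 4 apply: ord2_ind;
  rewrite /potential_dchristoffel /potential_christoffel /potential_metric /sym2 /= /monomial;
  move: (u 0 0) (u 0 1) y0 => x y y0; field; rewrite ?y0 //.
Qed.

(** The coefficients [a], [b], [c], [d] refer to the frame dual to dz_1 - (x / y) dz_2
    and dz_2, in which the metric is diagonal; it makes the dependence on x
    disappear. *)
Lemma anti_bisectional_potential (p : 'rV[R]_(2 + 2)) (eta xi : 'rV[R]_2) :
  tangent_bundle (half_plane R) p ->
  let x := lsubmx p 0 0 in let y := lsubmx p 0 1 in
  let a := xi 0 0 - x / y * xi 0 1 in let b := xi 0 1 in
  let c := eta 0 0 - x / y * eta 0 1 in let d := eta 0 1 in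
  anti_bisectional (potential R) p eta xi =
  a ^+ 2 * c ^+ 2 / (4 * y ^+ 2) + a * b * c * d / y ^+ 3 - b ^+ 2 * d ^+ 2 / (2 * y ^+ 4).
Proof.
move=> Hp x y a b c d; have y0 : y != 0 := half_plane_neq0 Hp.
rewrite (anti_bisectionalE (@open_half_plane R) (@hessian_regular_potential R)) // /Riem.
under eq_bigr do under eq_bigr do under eq_bigr do under eq_bigr do
  rewrite (lowered_mixed_curvature_potential _ _ _ _ Hp).
under [X in _ - X]eq_bigr do under eq_bigr do under eq_bigr do under eq_bigr do
  rewrite (lowered_curvature_potential _ _ _ _ Hp).
rewrite !sum2E /sym2 /= /monomial -/x -/y /a /b /c /d.
move: (xi 0 0) (xi 0 1) (eta 0 0) (eta 0 1) x y y0 {a b c d Hp} => a b c d x y y0.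
field; rewrite ?y0 //.
Qed.

Lemma NOAB_potential : NOAB (half_plane R) (potential R).
Proof.
move=> p Hp xi eta orth; rewrite anti_bisectional_potential //.
set x := lsubmx p 0 0; set y := lsubmx p 0 1.
set a := xi 0 0 - _; set b := xi 0 1; set c := eta 0 0 - _; set d := eta 0 1.
have y0 : y != 0 := half_plane_neq0 Hp.
(* Orthogonality in the diagonal frame. *)
have bd : b * d = y * (a * c).
  move: orth; rewrite /pairing !mxE !sum2E !mxE !sum2E !(hessian_potentialE _ _ Hp).
  rewrite /potential_metric /sym2 /= /monomial -/x -/y -/b -/d => orth.
  have : b * d - y * (a * c) = 0.
    rewrite -[RHS](mulr0 (2 * y ^+ 2)) -orth /a /c /b /d.
    move: (xi 0 0) (xi 0 1) (eta 0 0) (eta 0 1) x y y0 {orth a b c d} => a b c d x y y0.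
    by field; rewrite ?y0.
  by move/eqP; rewrite subr_eq0 => /eqP.
have -> : a ^+ 2 * c ^+ 2 / (4 * y ^+ 2) + a * b * c * d / y ^+ 3 - b ^+ 2 * d ^+ 2 / (2 * y ^+ 4)
   = 3 * (a * c / (2 * y)) ^+ 2.
  have -> : a * b * c * d = a * c * (b * d) by ring.
  by rewrite -[b ^+ 2 * d ^+ 2]exprMn bd; field; rewrite ?y0.
by rewrite mulr_ge0 ?sqr_ge0.
Qed.
End NOABPotential.

(** * Mean value estimates *)

Lemma near_norm (R : realType) (V : normedModType R) (P : set V) (p : V) :
  (\forall q \near p, P q) -> exists2 r : R, 0 < r & forall q, `|q - p| < r -> P q.
Proof.
case/nbhs_ballP => r r0 rP; exists r => // q qr; apply: rP.
by rewrite -ball_normE /= distrC.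
Qed.

Lemma MVT_line (R : realType) (V : normedModType R) (f : V -> R) (p v : V) :
  (forall t, 0 <= t <= 1 -> differentiable f (p + t *: v)) ->
  exists2 t, 0 <= t <= 1 & f (p + v) - f p = 'd f (p + t *: v) v.
Proof.
move=> df; pose g t := f (p + t *: v).
have dg (t : R) : 0 <= t <= 1 -> is_derive t 1 g ('d f (p + t *: v) v).
  move=> t01.
  have il : is_diff t (fun t : R => p + t *: v) ( *:%R ^~ v).
    by have := is_diffD (is_diff_cst p t) (is_diff_scalel t v); rewrite add0r.
  have ig := is_diff_comp il (differentiableP (df t t01)).
  have dif : differentiable g t by exact: ex_diff.
  split; first exact: diff_derivable.
  by rewrite deriveE // (diff_val (is_diff_def := ig)) /= scale1r.
have [t t01 E] : exists2 t, t \in `[0, 1]%R & g 1 - g 0 = 'd f (p + t *: v) v * (1 - 0).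
  apply: MVT_segment; first exact: ler01.
    by move=> x /[!in_itv]/= /andP[x0 x1]; apply: dg; rewrite !ltW.
  apply: derivable_within_continuous => x /[!in_itv]/= x01.
  by have := dg _ x01 => -[].
exists t; first by rewrite in_itv in t01.
by move: E; rewrite /g scale1r scale0r addr0 subr0 mulr1.
Qed.

Lemma diff_partial (R : realType) n (f : 'rV[R]_n -> R) p w : differentiable f p ->
  'd f p w = \sum_i w 0 i * partial i f p.
Proof.
move=> df; rewrite {1}[w]row_sum_delta linear_sum /=; apply: eq_bigr => i _.
by rewrite linearZ /= /partial deriveE.
Qed.

(** A function with continuous partial derivatives is strictly differentiable:
    along the segment from [q] to [q'] the partial derivatives are close to their
    values at [p]. *)
Lemma strict_derivative (R : realType) n (f : 'rV[R]_n -> R) (U : set 'rV[R]_n) p e :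
  open U -> U p -> Ck 1 U f -> 0 < e ->
  exists2 r, 0 < r & forall q q', `|q - p| < r -> `|q' - p| < r ->
    `|f q' - f q - 'd f p (q' - q)| <= e * `|q' - q|.
Proof.
move=> Uo Up [df cf] e0.
have en0 : 0 < e / n.+1%:R by rewrite divr_gt0.
have : \forall q \near p, U q /\ forall i, `|partial i f q - partial i f p| <= e / n.+1%:R.
  near=> q; split; first by near: q; exact: open_nbhs_nbhs.
  move=> i; move: i; near: q; apply: filter_forall => i.
  have /cvgrPdist_le/(_ _ en0) := cf i p Up.
  by apply: filterS => q; rewrite distrC.
case/near_norm => r r0 rP; exists r => // q q' qr q'r.
have inball t : 0 <= t <= 1 -> `|q + t *: (q' - q) - p| < r.
  move=> /andP[t0 t1].
  have -> : q + t *: (q' - q) - p = (1 - t) *: (q - p) + t *: (q' - p).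
    by apply/rowP => j; rewrite !mxE; ring.
  apply: le_lt_trans (ler_normD _ _) _; rewrite !normrZ (ger0_norm t0) ger0_norm ?subr_ge0 //.
  have [->|tn0] := eqVneq t 0; first by rewrite subr0 mul1r mul0r addr0.
  have tp : 0 < t by rewrite lt0r tn0.
  have h1 : (1 - t) * `|q - p| <= (1 - t) * r by rewrite ler_wpM2l ?subr_ge0 // ltW.
  have h2 : t * `|q' - p| < t * r by rewrite ltr_pM2l.
  by apply: lt_le_trans (ler_ltD h1 h2) _; rewrite -mulrDl subrK mul1r.
have [t t01 E] : exists2 t, 0 <= t <= 1 & f (q + (q' - q)) - f q = 'd f (q + t *: (q' - q)) (q' - q).
  by apply: MVT_line => t t01; apply: df; have [] := rP _ (inball _ t01).
rewrite [q + _]addrC subrK in E.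
have [Ut ct] := rP _ (inball _ t01).
rewrite (etrans E (diff_partial (q' - q) (df _ Ut))) (diff_partial (q' - q) (df _ Up)).
rewrite -sumrB; apply: le_trans (ler_norm_sum _ _ _) _.
apply: (@le_trans _ _ (\sum_(i < n) e / n.+1%:R * `|q' - q|)).
  apply: ler_sum => i _; rewrite -mulrBr normrM mulrC.
  by apply: ler_pM => //; first [exact: ct | exact: coord_norm_le].
rewrite sumr_const card_ord -[_ *+ n]mulr_natr mulrAC ler_wpM2r //.
rewrite -mulrA ler_piMr ?(ltW e0) // mulrC ler_pdivrMr // mul1r ler_nat //.
Unshelve. all: by end_near. Qed.

(** If f' is bounded then f (w + h) - f w is bounded in w, hence constant by
    Liouville; so f is additive up to a constant and f' is constant. *)
Lemma entire_bounded_derivative (R : realType) (U V : 'rV[R]_(1 + 1) -> R) K :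
  let e1 : 'rV[R]_(1 + 1) := row_mx 1%:M 0%:M in
  (forall w, cauchy_riemann U V w) ->
  (forall w, `|'d U w e1| <= K) -> (forall w, `|'d V w e1| <= K) ->
  forall w, U w = U 0 + 'd U 0 w.
Proof.
move=> e1 cr UK VK.
have pt_e1 (w : 'rV[R]_(1 + 1)) : w = lsubmx w 0 0 *: e1 + rsubmx w 0 0 *: (e1 *m Jmx R 1).
  rewrite /e1 pt_mulJ oppr0 !scale_row_mx add_row_mx !scale_scalar_mx !mulr1 !mulr0.
  by rewrite !raddf0 addr0 add0r; exact: pt_coord.
have K0 : 0 <= K := le_trans (normr_ge0 _) (UK 0).
have difU w : differentiable U w by have [? [? [i _ _]]] := cr w; exact: ex_diff.
have difV w : differentiable V w by have [? [? [_ i _]]] := cr w; exact: ex_diff.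
have dJ w : 'd U w (e1 *m Jmx R 1) = - 'd V w e1 /\ 'd V w (e1 *m Jmx R 1) = 'd U w e1.
  have [dU [dV [iU iV J]]] := cr w.
  have dUE v : 'd U w v = dU v by have -> := diff_val (is_diff_def := iU).
  have dVE v : 'd V w v = dV v by have -> := diff_val (is_diff_def := iV).
  split; first exact: (etrans (dUE _) (etrans (J e1).1 (congr1 -%R (esym (dVE e1))))).
  exact: (etrans (dVE _) (etrans (J e1).2 (esym (dUE e1)))).
pose N (h : 'rV[R]_(1 + 1)) := (`|lsubmx h 0 0| + `|rsubmx h 0 0|) * K.
have dbound (F : 'rV[R]_(1 + 1) -> R) w h : differentiable F w -> `|'d F w e1| <= K ->
    `|'d F w (e1 *m Jmx R 1)| <= K -> `|'d F w h| <= N h.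
  move=> dF F1 FJ; rewrite {1}[h]pt_e1 linearD !linearZ /= /GRing.scale /=.
  rewrite /N mulrDl; apply: le_trans (ler_normD _ _) _; rewrite !normrM.
  by apply: lerD; apply: ler_wpM2l.
have Ubound w h : `|U (w + h) - U w| <= N h.
  have [t _ ->] := MVT_line (fun t _ => difU (w + t *: h)).
  by apply: dbound => //; rewrite (dJ _).1 normrN.
have Vbound w h : `|V (w + h) - V w| <= N h.
  have [t _ ->] := MVT_line (fun t _ => difV (w + t *: h)).
  by apply: dbound => //; rewrite (dJ _).2.
have additive w h : U (w + h) - U w = U h - U 0.
  have tr (F : 'rV[R]_(1 + 1) -> R) v : F (h + (lsubmx v 0 0 *: e1 + rsubmx v 0 0 *: (e1 *m Jmx R 1))) = F (v + h).
    by rewrite -pt_e1 addrC.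
  have crh v : cauchy_riemann (fun v => U (v + h) + - U v) (fun v => V (v + h) + - V v) v.
    apply: cauchy_riemannD; last by do 2 apply: cauchy_riemann_rot.
    have := @cauchy_riemann_comp _ _ _ U V _ _ h e1 v (cauchy_riemann_coord 0 v) (cr _).
    under [X in cauchy_riemann X _ _]funext do rewrite tr.
    by under [X in cauchy_riemann _ X _]funext do rewrite tr.
  have := Liouville crh (fun v => Ubound v h) (fun v => Vbound v h) w 0.
  by rewrite add0r.
have dconst w v : 'd U w v = 'd U 0 v.
  suff E : 'D_v U w = 'D_v U 0.
    exact: (etrans (esym (deriveE v (difU w))) (etrans E (deriveE v (difU 0)))).
  have E : (fun h : R => h^-1 *: ((U \o shift w) (h *: v) - U w)) =
    (fun h : R => h^-1 *: ((U \o shift 0) (h *: v) - U 0)).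
    by apply/funext => h /=; rewrite addr0 [_ *: v + w]addrC additive.
  by rewrite /derive E.
move=> w.
have z : forall v, is_diff v (fun w => U w - 'd U 0 w) (cst 0).
  move=> v; have iL : is_diff v ('d U 0) ('d U 0).
    have c0 : continuous ('d U 0) := diff_continuous (difU 0).
    by split; [exact: linear_differentiable c0 | exact: diff_lin c0].
  have E : ('d U v : 'rV[R]_(1 + 1) -> R) - ('d U 0 : 'rV[R]_(1 + 1) -> R) = cst 0.
    by apply/funext => x; apply/eqP; rewrite subr_eq0; apply/eqP; exact: dconst.
  by rewrite -E; exact: is_diffB (differentiableP (difU v)) iL.
have c : U w - 'd U 0 w = U 0 - 'd U 0 0 := diff0_cst z w 0.
by apply/eqP; rewrite -subr_eq c (_ : 'd U 0 0 = 0) ?subr0 //; exact: linear0.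
Qed.

(** * Isolated fixed points of holomorphic isometries *)

Section Coordinates.
Variables (R : realType) (n : nat).
Implicit Types (u v : 'rV[R]_(n + n)) (k : 'I_n).

Lemma re_add u v k : lsubmx (u + v) 0 k = lsubmx u 0 k + lsubmx v 0 k.
Proof. by rewrite !mxE. Qed.
Lemma im_add u v k : rsubmx (u + v) 0 k = rsubmx u 0 k + rsubmx v 0 k.
Proof. by rewrite !mxE. Qed.
Lemma re_scale a u k : lsubmx (a *: u) 0 k = a * lsubmx u 0 k.
Proof. by rewrite !mxE. Qed.
Lemma im_scale a u k : rsubmx (a *: u) 0 k = a * rsubmx u 0 k.
Proof. by rewrite !mxE. Qed.
Lemma re_opp u k : lsubmx (- u) 0 k = - lsubmx u 0 k.
Proof. by rewrite !mxE. Qed.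
Lemma im_opp u k : rsubmx (- u) 0 k = - rsubmx u 0 k.
Proof. by rewrite !mxE. Qed.
Lemma re_J u k : lsubmx (u *m Jmx R n) 0 k = - rsubmx u 0 k.
Proof. by rewrite lsubmxJ mxE. Qed.
Lemma im_J u k : rsubmx (u *m Jmx R n) 0 k = lsubmx u 0 k.
Proof. by rewrite rsubmxJ. Qed.
Lemma re_real (w : 'rV[R]_n) k : lsubmx (real_vector w) 0 k = w 0 k.
Proof. by rewrite row_mxKl. Qed.
Lemma im_real (w : 'rV[R]_n) k : rsubmx (real_vector w) 0 k = 0.
Proof. by rewrite row_mxKr mxE. Qed.

Definition coordE := (re_add, im_add, re_scale, im_scale, re_opp, im_opp, re_J, im_J,
  re_real, im_real).

Lemma coord_eq u v : (forall k, lsubmx u 0 k = lsubmx v 0 k) ->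
  (forall k, rsubmx u 0 k = rsubmx v 0 k) -> u = v.
Proof.
move=> L1 L2; rewrite -[u]hsubmxK -[v]hsubmxK; congr row_mx; exact/rowP.
Qed.
End Coordinates.

(** Completing the square in the Hessian metric. *)
Lemma pairing_potential (R : realType) (q v w : 'rV[R]_(2 + 2)) :
  tangent_bundle (half_plane R) q ->
  let x := lsubmx q 0 0 in let y := lsubmx q 0 1 in
  let theta_re u := lsubmx u 0 0 - x / y * lsubmx u 0 1 in
  let theta_im u := rsubmx u 0 0 - x / y * rsubmx u 0 1 in
  pairing (sasaki (potential R) q) v w =
  - (2 * y)^-1 * (theta_re v * theta_re w + theta_im v * theta_im w)
  + (2 * y ^+ 2)^-1 * (lsubmx v 0 1 * lsubmx w 0 1 + rsubmx v 0 1 * rsubmx w 0 1).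
Proof.
move=> Hq x y theta_re theta_im.
have y0 : y != 0 := half_plane_neq0 Hq.
have -> : pairing (sasaki (potential R) q) v w =
  pairing (hessian (potential R) (lsubmx q)) (lsubmx v) (lsubmx w)
  + pairing (hessian (potential R) (lsubmx q)) (rsubmx v) (rsubmx w).
  rewrite /pairing /sasaki -{1}[v]hsubmxK -{1}[w]hsubmxK mul_row_block.
  by rewrite tr_row_mx mul_row_col !mulmx0 addr0 add0r mxE.
have pE (a b : 'rV[R]_2) : pairing (hessian (potential R) (lsubmx q)) a b =
  - (2 * y)^-1 * ((a 0 0 - x / y * a 0 1) * (b 0 0 - x / y * b 0 1))
  + (2 * y ^+ 2)^-1 * (a 0 1 * b 0 1).
  rewrite /pairing mxE sum2E ![(_ *m _) _ _]mxE !sum2E !(hessian_potentialE _ _ Hq).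
  rewrite ![_^T _ _]mxE.
  rewrite /potential_metric /sym2 /= /monomial -/x -/y.
  by move: (a 0 0) (a 0 1) (b 0 0) (b 0 1) x y y0 {theta_re theta_im} => *; field.
by rewrite !pE /theta_re /theta_im; ring.
Qed.

Lemma max_half_eq0 (R : realType) (a b c : R) : 0 <= a -> 0 <= b ->
  c <= Num.max a b -> 2 * a <= 2^-1 * c -> 2 * b <= 2^-1 * c -> a = 0 /\ b = 0.
Proof. by rewrite le_max => a0 b0 /orP[] ca h1 h2; split; lra. Qed.

Section Symmetry.
Variable R : realType.
Local Notation M := (tangent_bundle (half_plane R)).
Local Notation J := (Jmx R 2).
Local Notation re k q := (lsubmx q 0 k).
Local Notation im k q := (rsubmx q 0 k).

(* The directions of u_1 and u_2; with their images under J they span the fibre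
   directions (z_2 = const) and a complement. *)
Let E : 'rV[R]_(2 + 2) := real_vector (delta_mx 0 0).
Let F : 'rV[R]_(2 + 2) := real_vector (delta_mx 0 1).
Let vert a b := a *: E + b *: (E *m J).
Let horiz a b := a *: F + b *: (F *m J).

Let Ec : (re 0 E = 1) * (re 1 E = 0) * (im 0 E = 0) * (im 1 E = 0).
Proof. by rewrite !coordE !mxE. Qed.
Let Fc : (re 0 F = 0) * (re 1 F = 1) * (im 0 F = 0) * (im 1 F = 0).
Proof. by rewrite !coordE !mxE. Qed.

Lemma vertE a b : (re 0 (vert a b) = a) * (re 1 (vert a b) = 0) *
  (im 0 (vert a b) = b) * (im 1 (vert a b) = 0).
Proof. by rewrite /vert !coordE !mxE /=; do !split; ring. Qed.

Lemma horizE a b : (re 0 (horiz a b) = 0) * (re 1 (horiz a b) = a) *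
  (im 0 (horiz a b) = 0) * (im 1 (horiz a b) = b).
Proof. by rewrite /horiz !coordE !mxE /=; do !split; ring. Qed.

Lemma tangent_bundle_vert q a b : M q -> M (q + vert a b).
Proof. by rewrite /tangent_bundle /half_plane /= re_add vertE addr0. Qed.

Lemma open_tangent_bundle : open M.
Proof.
have -> : M = (fun q : 'rV[R]_(2 + 2) => q 0 (lshift 2 1)) @^-1` [set y | y < 0].
  by apply/seteqP; split => q; rewrite /tangent_bundle /half_plane /= mxE.
by apply: open_comp; [move=> u _; exact: coord_continuous|exact: open_lt].
Qed.

(* [ds q] is the differential of the isometry [s] at [q], kept as a variable so
   that it stays opaque to unification. *)
Variables (s : 'rV[R]_(2 + 2) -> 'rV[R]_(2 + 2))
  (ds : 'rV[R]_(2 + 2) -> {linear 'rV[R]_(2 + 2) -> 'rV[R]_(2 + 2)}).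
Hypothesis sM : forall q, M q -> M (s q) /\ s (s q) = q.
Hypothesis sd : forall q, M q -> is_diff q s (ds q).
Hypothesis dsJ : forall q w, M q -> ds q (w *m J) = ds q w *m J.
Hypothesis iso : forall q, M q -> forall v w,
  pairing (sasaki (potential R) (s q)) (ds q v) (ds q w) =
  pairing (sasaki (potential R) q) v w.

Let theta (q u : 'rV[R]_(2 + 2)) := re 0 u - re 0 q / re 1 q * re 1 u.
Let theta' (q u : 'rV[R]_(2 + 2)) := im 0 u - re 0 q / re 1 q * im 1 u.

Let isoE q v w : M q ->
  - (2 * re 1 (s q))^-1 * (theta (s q) (ds q v) * theta (s q) (ds q w)
      + theta' (s q) (ds q v) * theta' (s q) (ds q w))
  + (2 * re 1 (s q) ^+ 2)^-1 * (re 1 (ds q v) * re 1 (ds q w) + im 1 (ds q v) * im 1 (ds q w))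
  = - (2 * re 1 q)^-1 * (theta q v * theta q w + theta' q v * theta' q w)
  + (2 * re 1 q ^+ 2)^-1 * (re 1 v * re 1 w + im 1 v * im 1 w).
Proof.
move=> Mq; have [Ms _] := sM Mq.
exact: (etrans (esym (pairing_potential (ds q v) (ds q w) Ms))
  (etrans (iso Mq v w) (pairing_potential v w Mq))).
Qed.

Let sre k q : M q -> is_diff q (fun q => re k (s q)) (fun w => re k (ds q w)).
Proof. by move=> Mq; exact: (is_diff_comp (sd Mq) (is_diff_re k (s q))). Qed.

Let sim k q : M q -> is_diff q (fun q => im k (s q)) (fun w => im k (ds q w)).
Proof. by move=> Mq; exact: (is_diff_comp (sd Mq) (is_diff_im k (s q))). Qed.

Let crs k q : M q -> cauchy_riemann (fun q => re k (s q)) (fun q => im k (s q)) q.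
Proof.
move=> Mq; do 2 eexists; split; [exact: sre|exact: sim|move=> w /=].
by rewrite dsJ // !coordE.
Qed.

Let fibre q (w : 'rV[R]_(1 + 1)) := q + vert (re 0 w) (im 0 w).

Let crh k q w : M q -> cauchy_riemann (fun w => re k (s (fibre q w))) (fun w => im k (s (fibre q w))) w.
Proof.
move=> Mq; apply: (@cauchy_riemann_comp _ _ _ (fun q => re k (s q)) (fun q => im k (s q))).
  exact: cauchy_riemann_coord.
by apply: crs; exact: tangent_bundle_vert.
Qed.

Let pt (a b : R) : 'rV[R]_(1 + 1) := row_mx a%:M b%:M.

Let fibre_pt q a b : fibre q (pt a b) = q + vert a b.
Proof. by rewrite /fibre lsubmx_pt rsubmx_pt. Qed.

Let vert0 : vert 0 0 = 0.
Proof. by rewrite /vert !scale0r addr0. Qed.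

(** On a fibre, which is a complex line, the z_2-component of [s] is an entire
    function with negative real part. *)
Lemma base_constant q a b : M q ->
  re 1 (s (q + vert a b)) = re 1 (s q) /\ im 1 (s (q + vert a b)) = im 1 (s q).
Proof.
move=> Mq; have neg w : re 1 (s (fibre q w)) < 0.
  by have [] := sM (tangent_bundle_vert (re 0 w) (im 0 w) Mq).
have := Liouville_half_plane (fun w => crh 1 w Mq) neg (pt a b) (pt 0 0).
by rewrite !fibre_pt vert0 addr0.
Qed.

Lemma derive_cst_along n (f : 'rV[R]_n -> R) q v : (forall t, f (t *: v + q) = f q) ->
  'D_v f q = 0.
Proof.
move=> fv; rewrite /derive.
have -> : (fun t : R => t^-1 *: ((f \o shift q) (t *: v) - f q)) = cst 0.
  by apply/funext => t /=; rewrite fv subrr scaler0.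
exact: lim_cst.
Qed.

Lemma is_diff_derive n (f : 'rV[R]_n -> R) q v df : is_diff q f df -> 'D_v f q = df v.
Proof. by move=> i; rewrite deriveE; [rewrite diff_val | exact: ex_diff]. Qed.

Let tE q t : t *: E + q = q + vert t 0.
Proof. by rewrite /vert scale0r addr0 addrC. Qed.

Lemma dbase q : M q -> re 1 (ds q E) = 0 /\ im 1 (ds q E) = 0.
Proof.
move=> Mq; rewrite -(is_diff_derive E (sre 1 Mq)) -(is_diff_derive E (sim 1 Mq)).
by split; apply: derive_cst_along => t; rewrite tE;
  [exact: (base_constant t 0 Mq).1 | exact: (base_constant t 0 Mq).2].
Qed.

Lemma ds_vert q a b : M q -> ds q (vert a b) =
  vert (a * re 0 (ds q E) - b * im 0 (ds q E)) (a * im 0 (ds q E) + b * re 0 (ds q E)).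
Proof.
move=> Mq; have [r1 i1] := dbase Mq.
rewrite [ds q (vert a b)]linearD !linearZ /= dsJ //.
apply: coord_eq; apply: ord2_ind; rewrite [RHS]vertE !coordE ?r1 ?i1 /GRing.scale /=; ring.
Qed.

(** The squared length of the vector u_1 is 1 / (- 2 y), and [ds] maps it to a fibre
    vector. *)
Lemma fibre_scale q : M q ->
  re 1 (s q) = (re 0 (ds q E) ^+ 2 + im 0 (ds q E) ^+ 2) * re 1 q.
Proof.
move=> Mq; have [Ms _] := sM Mq; have [r1 i1] := dbase Mq.
have := isoE E E Mq; rewrite /theta /theta' r1 i1 !Ec.
have y0 := half_plane_neq0 Mq; have Y0 := half_plane_neq0 Ms.
move: (re 0 (ds q E)) (im 0 (ds q E)) (re 1 q) (re 1 (s q)) (re 0 q) (re 0 (s q)) y0 Y0.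
move=> a b y Y x X y0 Y0; rewrite !(mulr0, subr0, addr0, mulr1) => eq1.
have -> : (a ^+ 2 + b ^+ 2) = - (2 * Y) * (- (2 * Y)^-1 * (a * a + b * b)).
  by field.
by rewrite eq1; field.
Qed.

(** By [fibre_scale] and [base_constant] the derivative of [s] along a fibre has
    constant modulus, so [entire_bounded_derivative] applies. *)
Lemma fibre_affine q a b : M q -> s (q + vert a b) = s q + ds q (vert a b).
Proof.
move=> Mq; have [Ms _] := sM Mq; have [r1 i1] := dbase Mq.
pose K := re 1 (s q) / re 1 q + 1.
have dE w : ds (fibre q w) E = ds (fibre q w) (vert 1 0) by rewrite /vert scale1r scale0r addr0.
have bound (c d Y y : R) : y != 0 -> Y = (c ^+ 2 + d ^+ 2) * y -> `|c| <= Y / y + 1 /\ `|d| <= Y / y + 1.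
  move=> y0 ->; rewrite mulfK //.
  have sq1 (t : R) : `|t| <= t ^+ 2 + 1.
    rewrite -(real_normK (num_real t)).
    by have := sqr_ge0 (`|t| - 1); have := normr_ge0 t; move: `|t| => z; nra.
  by have := sq1 c; have := sq1 d; have := sqr_ge0 c; have := sqr_ge0 d; split; lra.
have Kb w : `|re 0 (ds (fibre q w) E)| <= K /\ `|im 0 (ds (fibre q w) E)| <= K.
  have Mh : M (fibre q w) by exact: tangent_bundle_vert.
  rewrite /K -(base_constant (re 0 w) (im 0 w) Mq).1.
  have -> : re 1 q = re 1 (fibre q w) by rewrite /fibre re_add vertE addr0.
  by apply: bound; [exact: half_plane_neq0|exact: fibre_scale].
have dh w k : is_diff w (fun w => re k (s (fibre q w))) (fun v => re k (ds (fibre q w) (vert (re 0 v) (im 0 v)))) /\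
   is_diff w (fun w => im k (s (fibre q w))) (fun v => im k (ds (fibre q w) (vert (re 0 v) (im 0 v)))).
  have Mh : M (fibre q w) by exact: tangent_bundle_vert.
  have ih : is_diff w (fibre q) (fun v => vert (re 0 v) (im 0 v)).
    have iU1 := is_diff_comp (is_diff_re 0 w) (is_diff_scalel (re 0 w) E).
    have iV1 := is_diff_comp (is_diff_im 0 w) (is_diff_scalel (im 0 w) (E *m J)).
    have := is_diffD (is_diff_cst q w) (is_diffD iU1 iV1).
    by rewrite add0r.
  by split; [exact: (is_diff_comp ih (sre k Mh))|exact: (is_diff_comp ih (sim k Mh))].
have h0 : fibre q 0 = q.
  by rewrite /fibre /vert !mxE !scale0r !addr0.
have [K1 K2] : (forall w, `|'d (fun w => re 0 (s (fibre q w))) w (pt 1 0)| <= K) /\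
               (forall w, `|'d (fun w => im 0 (s (fibre q w))) w (pt 1 0)| <= K).
  split=> w; have [i1' i2'] := dh w 0.
    have -> : 'd (fun w => re 0 (s (fibre q w))) w (pt 1 0) = re 0 (ds (fibre q w) E).
      by have -> := diff_val (is_diff_def := i1'); rewrite lsubmx_pt rsubmx_pt dE.
    by have [] := Kb w.
  have -> : 'd (fun w => im 0 (s (fibre q w))) w (pt 1 0) = im 0 (ds (fibre q w) E).
    by have -> := diff_val (is_diff_def := i2'); rewrite lsubmx_pt rsubmx_pt dE.
  by have [] := Kb w.
have aff := entire_bounded_derivative (fun w => crh 0 w Mq) K1 K2 (pt a b).
have crI w := cauchy_riemann_rot (crh 0 w Mq).
have K1' w : `|'d (fun w => - re 0 (s (fibre q w))) w (pt 1 0)| <= K.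
  have [i1' _] := dh w 0; have i3 := is_diffN i1'.
  have -> : 'd (fun w => - re 0 (s (fibre q w))) w (pt 1 0) = - re 0 (ds (fibre q w) E).
    by have -> := diff_val (is_diff_def := i3); rewrite !fctE lsubmx_pt rsubmx_pt dE.
  by rewrite normrN; have [] := Kb w.
have affI := entire_bounded_derivative crI K2 K1' (pt a b).
have [i1' i2'] := dh 0 0.
have aff1 : re 0 (s (q + vert a b)) = re 0 (s q) + re 0 (ds q (vert a b)).
  rewrite -fibre_pt -{2 3}h0 aff; congr (_ + _).
  by have -> := diff_val (is_diff_def := i1'); rewrite lsubmx_pt rsubmx_pt.
have aff2 : im 0 (s (q + vert a b)) = im 0 (s q) + im 0 (ds q (vert a b)).
  rewrite -fibre_pt -{2 3}h0 affI; congr (_ + _).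
  by have -> := diff_val (is_diff_def := i2'); rewrite lsubmx_pt rsubmx_pt.
have [b1 b2] := base_constant a b Mq.
by apply: coord_eq; apply: ord2_ind; rewrite !coordE // ?b1 ?b2 ds_vert // !vertE addr0.
Qed.

(** The differential of [s] preserves fibre directions and is an isometry, so it
    pulls dz_1 - (x / y) dz_2 back to a multiple of itself: the multiple is the
    derivative along the fibre.  Evaluated on u_2 this is the assertion. *)
Lemma cross_term q : M q ->
  re 0 (ds q F) = re 0 (s q) / re 1 (s q) * re 1 (ds q F) - re 0 (ds q E) * (re 0 q / re 1 q) /\
  im 0 (ds q F) = re 0 (s q) / re 1 (s q) * im 1 (ds q F) - im 0 (ds q E) * (re 0 q / re 1 q).
Proof.
move=> Mq; have [Ms _] := sM Mq; have [r1 i1] := dbase Mq.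
have := isoE (E *m J) F Mq; have := isoE E F Mq.
have := fibre_scale Mq; rewrite /theta /theta' dsJ // !(re_J, im_J) r1 i1 !Ec !Fc.
have y0 := half_plane_neq0 Mq; have Y0 := half_plane_neq0 Ms.
move: (re 0 (ds q E)) (im 0 (ds q E)) (re 1 q) (re 1 (s q)) (re 0 q) (re 0 (s q)) y0 Y0.
move: (re 0 (ds q F)) (im 0 (ds q F)) (re 1 (ds q F)) (im 1 (ds q F)).
move=> b1 b2 c1 c2 a1 a2 y Y x X y0 Y0 YE.
rewrite !(mulr0, subr0, addr0, mulr1, mul0r, add0r, oppr0, mul1r).
set t1 := b1 - X / Y * c1; set t2 := b2 - X / Y * c2 => e1 e2.
have N0 : a1 ^+ 2 + a2 ^+ 2 != 0.
  by apply: contra_neq Y0 => N0; rewrite YE N0 mul0r.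
have e1' : a1 * t1 + a2 * t2 = - (a1 ^+ 2 + a2 ^+ 2) * (x / y).
  have -> : a1 * t1 + a2 * t2 = - (2 * Y) * (- (2 * Y)^-1 * (a1 * t1 + a2 * t2)) by field.
  by rewrite e1 YE; field; rewrite y0 //.
have e2' : a1 * t2 = a2 * t1.
  have : a1 * t2 - a2 * t1 = - (2 * Y) * (- (2 * Y)^-1 * (- a2 * t1 + a1 * t2)) by field.
  by rewrite e2 ?mulr0 => /eqP; rewrite subr_eq0 => /eqP.
have T1 : t1 = - a1 * (x / y).
  apply: (mulfI N0).
  have -> : (a1 ^+ 2 + a2 ^+ 2) * t1 = a1 * (a1 * t1) + a2 * (a2 * t1) by ring.
  rewrite -e2'; transitivity (a1 * (a1 * t1 + a2 * t2)); first ring.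
  by rewrite e1'; ring.
have T2 : t2 = - a2 * (x / y).
  apply: (mulfI N0).
  have -> : (a1 ^+ 2 + a2 ^+ 2) * t2 = a1 * (a1 * t2) + a2 * (a2 * t2) by ring.
  rewrite e2'; transitivity (a2 * (a1 * t1 + a2 * t2)); first ring.
  by rewrite e1'; ring.
by split; [rewrite -[b1](subrK (X / Y * c1)) -/t1 T1 | rewrite -[b2](subrK (X / Y * c2)) -/t2 T2]; ring.
Qed.

Let near_M (P : set 'rV[R]_(2 + 2)) q : M q -> (forall q, M q -> P q) -> \forall q \near q, P q.
Proof.
move=> Mq HP; have : \forall q \near q, M q by exact: open_nbhs_nbhs (conj open_tangent_bundle Mq).
by apply: filterS.
Qed.

Let is_diff_translate n (f : 'rV[R]_n -> R) df (q v : 'rV[R]_n) : is_diff (q + v) f df ->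
  is_diff q (fun q => f (q + v)) df.
Proof.
move=> i; have := is_diffD (is_diff_id q) (is_diff_cst v q).
by rewrite addr0 => t; exact: (is_diff_comp t i).
Qed.

Lemma dbase_translate q a b : M q ->
  re 1 (ds (q + vert a b) F) = re 1 (ds q F) /\ im 1 (ds (q + vert a b) F) = im 1 (ds q F).
Proof.
move=> Mq; have Mv := tangent_bundle_vert a b Mq.
have t1 := is_diff_derive F (is_diff_translate (sre 1 Mv)).
have t2 := is_diff_derive F (is_diff_translate (sim 1 Mv)).
rewrite -t1 -t2 -(is_diff_derive F (sre 1 Mq)) -(is_diff_derive F (sim 1 Mq)).
by split; apply: near_eq_derive; apply: near_M => // v Mv'; have [] := base_constant a b Mv'.
Qed.

(** On each fibre, s (q + i) - s q = i (s (q + 1) - s q) by [fibre_affine]; this is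
    differentiated in the direction u_2. *)
Lemma cross_translate q : M q ->
  re 0 (ds (q + vert 0 1) F) - re 0 (ds q F) = - (im 0 (ds (q + vert 1 0) F) - im 0 (ds q F)) /\
  im 0 (ds (q + vert 0 1) F) - im 0 (ds q F) = re 0 (ds (q + vert 1 0) F) - re 0 (ds q F).
Proof.
move=> Mq; have M10 := tangent_bundle_vert 1 0 Mq; have M01 := tangent_bundle_vert 0 1 Mq.
have aff v : M v -> re 0 (s (v + vert 0 1)) - re 0 (s v) = - (im 0 (s (v + vert 1 0)) - im 0 (s v)) /\
    im 0 (s (v + vert 0 1)) - im 0 (s v) = re 0 (s (v + vert 1 0)) - re 0 (s v).
  by move=> Mv; rewrite !fibre_affine // !ds_vert // !(re_add (s v), im_add (s v)) !vertE; split; ring.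
have r0 := sre 0 Mq; have i0 := sim 0 Mq.
have r10 := is_diff_translate (sre 0 M10); have i10 := is_diff_translate (sim 0 M10).
have r01 := is_diff_translate (sre 0 M01); have i01 := is_diff_translate (sim 0 M01).
have d1 := is_diff_derive F (is_diffB r01 r0).
have d2 := is_diff_derive F (is_diffN (is_diffB i10 i0)).
have d3 := is_diff_derive F (is_diffB i01 i0).
have d4 := is_diff_derive F (is_diffB r10 r0).
split.
- apply: (etrans (esym d1) (etrans _ d2)).
  by apply: near_eq_derive; apply: near_M => // v Mv; exact: (aff v Mv).1.
- apply: (etrans (esym d3) (etrans _ d4)).
  by apply: near_eq_derive; apply: near_M => // v Mv; exact: (aff v Mv).2.
Qed.

Variable p : 'rV[R]_(2 + 2).
Hypotheses (Mp : M p) (sp : s p = p).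

Lemma ds_vert_translate a b : ds (p + vert a b) E = ds p E.
Proof.
have Mv := tangent_bundle_vert a b Mp.
have e1 := fibre_affine 1 0 Mv; have e2 := fibre_affine a b Mp.
have E10 : vert 1 0 = E by rewrite /vert scale1r scale0r addr0.
have vD : p + vert a b + vert 1 0 = p + vert (a + 1) b.
  by rewrite -addrA /vert scale0r addr0 addrAC -scalerDl.
have e3 := fibre_affine (a + 1) b Mp.
rewrite -vD e1 e2 -addrA in e3; move/addrI: e3.
have -> : vert (a + 1) b = vert a b + vert 1 0.
  by rewrite /vert scale0r addr0 addrAC -scalerDl.
by rewrite (linearD (ds p) (vert a b) (vert 1 0)) /= => /addrI; rewrite E10.
Qed.

(** Let a = a1 + i a2 be the derivative of [s] along the fibre at [p] and
    b = b1 + i b2 that of its z_2-component.  Inserting [cross_term] at p, p + 1 and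
    p + i into [cross_translate] gives conj a * b = a.  Moreover |a| = 1 by
    [fibre_scale] and a^2 = 1 because [s] is an involution, so b = 1. *)
Lemma dbase_fixed : re 1 (ds p F) = 1 /\ im 1 (ds p F) = 0.
Proof.
have y0 := half_plane_neq0 Mp.
have M10 := tangent_bundle_vert 1 0 Mp; have M01 := tangent_bundle_vert 0 1 Mp.
have [c1 c2] := cross_term Mp; have [c3 c4] := cross_term M10; have [c5 c6] := cross_term M01.
have [t1 t2] := cross_translate Mp; have := fibre_scale Mp.
rewrite ?(base_constant _ _ Mp).1 ?(dbase_translate _ _ Mp).1 ?(dbase_translate _ _ Mp).2
  ?ds_vert_translate ?(fibre_affine _ _ Mp) ?(ds_vert _ _ Mp) ?sp ?(re_add p) ?vertE
  in c1 c2 c3 c4 c5 c6 *.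
rewrite c1 c2 c3 c4 c5 c6 in t1 t2.
have [_] := sM M10.
rewrite fibre_affine // sp ds_vert // fibre_affine // sp ds_vert //.
move=> /addrI invol; have := congr1 (fun v => re 0 v) invol; have := congr1 (fun v => im 0 v) invol.
rewrite /= !vertE.
move: t1 t2.
move: (re 0 (ds p E)) (im 0 (ds p E)) (re 1 p) (re 0 p) y0.
move: (re 1 (ds p F)) (im 1 (ds p F)).
move=> b1 b2 a1 a2 y x y0.
rewrite !(mulr0, subr0, addr0, mulr1, mul0r, add0r, oppr0, mul1r, sub0r) => t1 t2 i1 i2 N1.
have N : a1 ^+ 2 + a2 ^+ 2 = 1 by apply: (mulIf y0); rewrite mul1r -N1.
have T1 : a1 * b2 - a2 * b1 = a2.
  apply/eqP; rewrite -subr_eq0; apply/eqP.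
  have : y * ((x + - a2) / y * b1 - a1 * (x / y) - (x / y * b1 - a1 * (x / y))
     + ((x + a1) / y * b2 - a2 * ((x + 1) / y) - (x / y * b2 - a2 * (x / y)))) = 0.
    by rewrite t1; ring.
  by move=> <-; field.
have T2 : a1 * b1 + a2 * b2 = a1.
  apply/eqP; rewrite -subr_eq0; apply/eqP.
  have : y * ((x + a1) / y * b1 - a1 * ((x + 1) / y) - (x / y * b1 - a1 * (x / y))
     - ((x + - a2) / y * b2 - a2 * (x / y) - (x / y * b2 - a2 * (x / y)))) = 0.
    by rewrite t2; ring.
  by move=> <-; field.
split.
- transitivity ((a1 ^+ 2 + a2 ^+ 2) * b1); first by rewrite N mul1r.
  transitivity (a1 * (a1 * b1 + a2 * b2) - a2 * (a1 * b2 - a2 * b1)); first ring.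
  by rewrite T1 T2 -i2; ring.
- transitivity ((a1 ^+ 2 + a2 ^+ 2) * b2); first by rewrite N mul1r.
  transitivity (a2 * (a1 * b1 + a2 * b2) + a1 * (a1 * b2 - a2 * b1)); first ring.
  by rewrite T1 T2 -i1; ring.
Qed.

Hypothesis smooth_s : forall j, Ck 1 M (fun q => s q 0 j).

Let norm_coord (u : 'rV[R]_(2 + 2)) c : 0 <= c ->
  `|re 0 u| <= c -> `|re 1 u| <= c -> `|im 0 u| <= c -> `|im 1 u| <= c -> `|u| <= c.
Proof.
move=> c0 r0 r1 i0 i1; apply: row_norm_le => // j.
have -> : u 0 j = row_mx (lsubmx u) (rsubmx u) 0 j by rewrite hsubmxK.
by rewrite mxE; case: splitP => k _; move: k; apply: ord2_ind.
Qed.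

Let coord_norm (u : 'rV[R]_(2 + 2)) k : `|re k u| <= `|u| /\ `|im k u| <= `|u|.
Proof. by rewrite !mxE; split; exact: coord_norm_le. Qed.

(** The map B induced on the z_2-coordinate is an involution with B'(p) = 1.  For
    D = B q - q, strict differentiability between q and q + D = B q says that
    B (B q) - B q - D = - 2 D is at most |D| / 2, so D = 0. *)
Lemma base_identity_near : exists2 r, 0 < r & forall q, `|q - p| < r ->
  M q /\ (re 1 (s q) = re 1 q /\ im 1 (s q) = im 1 q).
Proof.
have smooth_re : Ck 1 M (fun q => re 1 (s q)).
  rewrite (_ : (fun q => re 1 (s q)) = (fun q => s q 0 (lshift 2 1))) //.
  by apply/funext => q; rewrite mxE.
have smooth_im : Ck 1 M (fun q => im 1 (s q)).
  rewrite (_ : (fun q => im 1 (s q)) = (fun q => s q 0 (rshift 2 1))) //.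
  by apply/funext => q; rewrite mxE.
have half0 : 0 < 2^-1 :> R by rewrite invr_gt0.
have [r1 r10 S1] := strict_derivative open_tangent_bundle Mp smooth_re half0.
have [r2 r20 S2] := strict_derivative open_tangent_bundle Mp smooth_im half0.
have [r3 r30 S3] : exists2 r, 0 < r & forall q, `|q - p| < r -> M q.
  by apply: near_norm; exact: open_nbhs_nbhs (conj open_tangent_bundle Mp).
pose r := Num.min r1 (Num.min r2 r3).
have r0 : 0 < r by rewrite !lt_min r10 r20.
have rr1 : r <= r1 by rewrite ge_min lexx.
have rr2 : r <= r2 by rewrite !ge_min lexx orbT.
have rr3 : r <= r3 by rewrite !ge_min lexx !orbT.
have cs : {for p, continuous s} by apply: differentiable_continuous; exact: (ex_diff (is_diff_def := sd Mp)).
have [r4 r40 S4] : exists2 d, 0 < d & forall q, `|q - p| < d -> `|s q - p| < r.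
  by apply: near_norm; move/cvgrPdist_lt : cs => /(_ _ r0); rewrite sp; apply: filterS => q; rewrite distrC.
exists (Num.min r r4); first by rewrite lt_min r0.
move=> q; rewrite lt_min => /andP[qr qr4]; have Mq : M q by apply: S3; exact: lt_le_trans qr rr3.
split => //.
(* q + D lies in the fibre of s q, where B takes the value B (B q) = q. *)
pose D := horiz (re 1 (s q) - re 1 q) (im 1 (s q) - im 1 q).
have [Ms ss] := sM Mq.
have qD : q + D = s q + vert (re 0 q - re 0 (s q)) (im 0 q - im 0 (s q)).
  apply: coord_eq; apply: ord2_ind;
  rewrite !(re_add q, im_add q, re_add (s q), im_add (s q)) vertE horizE; ring.
have [f1 f2] := base_constant (re 0 q - re 0 (s q)) (im 0 q - im 0 (s q)) Ms.
rewrite -qD ss in f1 f2.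
have qDr : `|q + D - p| < r.
  apply: le_lt_trans (_ : Num.max `|q - p| `|s q - p| < r); last by rewrite gt_max qr S4.
  have le_max_of (a b c d : R) k : k = a \/ k = b -> `|a| <= c -> `|b| <= d -> `|k| <= Num.max c d.
    by move=> [->|->] h1 h2; rewrite le_max ?h1 ?h2 ?orbT.
  have [qr0 qi0] := coord_norm (q - p) 0; have [qr1 qi1] := coord_norm (q - p) 1.
  have [sr0 si0] := coord_norm (s q - p) 0; have [sr1 si1] := coord_norm (s q - p) 1.
  apply: norm_coord; first by rewrite le_max normr_ge0.
  - by apply: le_max_of qr0 sr0; left; rewrite !(re_add (q + D), re_add q) horizE addr0.
  - by apply: le_max_of qr1 sr1; right; rewrite !(re_add (q + D), re_add q, re_add (s q)) horizE; ring.
  - by apply: le_max_of qi0 si0; left; rewrite !(im_add (q + D), im_add q) horizE addr0.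
  - by apply: le_max_of qi1 si1; right; rewrite !(im_add (q + D), im_add q, im_add (s q)) horizE; ring.
have [b1 b2] := dbase_fixed.
have dsD : re 1 (ds p D) = re 1 D /\ im 1 (ds p D) = im 1 D.
  rewrite (linearD (ds p) ((re 1 (s q) - re 1 q) *: F) ((im 1 (s q) - im 1 q) *: (F *m J))).
  rewrite !linearZ /= dsJ // !(re_add (_ *: ds p F), im_add (_ *: ds p F)) !(re_scale, im_scale).
  by rewrite re_J im_J b1 b2 /D !horizE; split; ring.
have dE1 : 'd (fun q => re 1 (s q)) p (q + D - q) = re 1 D.
  have i := sre 1 Mp; have -> := diff_val (is_diff_def := i).
  by rewrite addrAC subrr add0r dsD.1.
have dE2 : 'd (fun q => im 1 (s q)) p (q + D - q) = im 1 D.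
  have i := sim 1 Mp; have -> := diff_val (is_diff_def := i).
  by rewrite addrAC subrr add0r dsD.2.
have := S1 q (q + D) (lt_le_trans qr rr1) (lt_le_trans qDr rr1).
have := S2 q (q + D) (lt_le_trans qr rr2) (lt_le_trans qDr rr2).
rewrite dE1 dE2 f1 f2 [q + D - q]addrAC subrr add0r !horizE.
set d1 := re 1 (s q) - re 1 q; set d2 := im 1 (s q) - im 1 q.
have -> : re 1 q - re 1 (s q) - d1 = - 2 * d1 by rewrite /d1; ring.
have -> : im 1 q - im 1 (s q) - d2 = - 2 * d2 by rewrite /d2; ring.
have nD : `|D| <= Num.max `|d1| `|d2|.
  by apply: norm_coord; rewrite /D ?horizE ?normr0 ?le_max ?normr_ge0 ?lexx ?orbT.
rewrite !normrM normrN (ger0_norm (ler0n _ 2)) => h2 h1.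
have [] := max_half_eq0 (normr_ge0 d1) (normr_ge0 d2) nD h1 h2.
move=> /normr0_eq0/eqP; rewrite subr_eq0 => /eqP -> /normr0_eq0/eqP.
by rewrite subr_eq0 => /eqP ->.
Qed.

(** On the fibre through p + t u_2 the map [s] is an affine involution; it fixes the
    midpoint of p + t u_2 and its image, which tends to p with t. *)
Lemma fixed_point_not_isolated : ~ (\forall q \near p, s q = q -> q = p).
Proof.
case/near_norm => r r0 isol; have [r' r'0 base] := base_identity_near.
have cs : {for p, continuous s} by apply: differentiable_continuous; exact: (ex_diff (is_diff_def := sd Mp)).
have [d d0 S4] : exists2 d, 0 < d & forall q, `|q - p| < d -> `|s q - p| < r.
  by apply: near_norm; move/cvgrPdist_lt : cs => /(_ _ r0); rewrite sp; apply: filterS => q; rewrite distrC.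
pose t := Num.min r (Num.min r' d) / 2.
have m0 : 0 < Num.min r (Num.min r' d) by rewrite !lt_min r0 r'0.
have t0 : 0 < t by rewrite divr_gt0.
have tm : t < Num.min r (Num.min r' d) by rewrite /t ltr_pdivrMr // ltr_pMr // ltr1n.
move: (tm); rewrite !lt_min => /and3P[tr tr' td].
pose q := p + horiz t 0.
have qp : `|q - p| <= t.
  by rewrite /q addrC addrA addNr add0r; apply: norm_coord; rewrite ?horizE ?normr0 ?(ltW t0) // ger0_norm // ltW.
have [Mq [B1 B2]] := base q (le_lt_trans qp tr').
have sq : s q = q + vert (re 0 (s q) - re 0 q) (im 0 (s q) - im 0 q).
  by apply: coord_eq; apply: ord2_ind; rewrite !(re_add q, im_add q) vertE; lra.
set a := re 0 (s q) - re 0 q in sq; set b := im 0 (s q) - im 0 q in sq.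
have [_ ss] := sM Mq.
have neg : ds q (vert a b) = - vert a b.
  have := fibre_affine a b Mq; rewrite -sq ss => e.
  apply: (addrI (s q)); rewrite -e; apply/eqP.
  by rewrite [in eqbRHS]sq addrK.
pose m := q + vert (a / 2) (b / 2).
have half : vert (a / 2) (b / 2) = 2^-1 *: vert a b.
  by rewrite /vert scalerDr !scalerA ![2^-1 * _]mulrC.
have sm : s m = m.
  rewrite /m fibre_affine // half linearZ /= neg sq -addrA; congr (_ + _).
  by apply/rowP => j; rewrite !mxE; field.
have mp : m = p.
  apply: isol => //.
  have -> : m - p = 2^-1 *: (q - p) + 2^-1 *: (s q - p).
    by rewrite /m half sq; apply/rowP => j; rewrite !mxE; field.
  apply: le_lt_trans (ler_normD _ _) _; rewrite !normrZ ger0_norm ?invr_ge0 //.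
  have h1 := le_lt_trans qp tr; have h2 := S4 q (le_lt_trans qp td).
  by rewrite -mulrDr ltr_pdivrMl //; lra.
have : re 1 m = re 1 p + t.
  by rewrite /m (re_add q) vertE addr0 (re_add p) horizE.
by rewrite mp => /eqP; rewrite -subr_eq0 opprD addrA subrr sub0r oppr_eq0 gt_eqF.
Qed.

End Symmetry.

Theorem not_hermitian_symmetric_potential (R : realType) :
  ~ hermitian_symmetric (tangent_bundle (half_plane R)) (sasaki (potential R)).
Proof.
have Mp : tangent_bundle (half_plane R) (const_mx (-1)).
  by rewrite /tangent_bundle /half_plane /= !mxE ltrN10.
move=> sym; have [s [sM [smooth_s hol] iso sp isol]] := sym _ Mp.
apply: (@fixed_point_not_isolated R s (fun q => 'd s q) sM _ _ iso _ Mp sp _ isol).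
- by move=> q Mq; have [dq _] := hol q Mq; exact: differentiableP.
- by move=> q w Mq; have [_ ->] := hol q Mq.
- by move=> j; exact: smooth_s 1%N j.
Qed.

(** * Growth of a function along a curve *)

Section CurveEstimate.
Variables (R : realType) (n : nat).
Variables (c : R -> 'rV[R]_n) (N : R -> R) (f : 'rV[R]_n -> R) (K : R).
Hypothesis cC1 : C1_curve c.
Hypothesis Ncont : forall t : R, 0 <= t <= 1 -> {for t, continuous N}.
Hypothesis N0 : forall t, 0 <= N t.

Lemma speed_integrable : lebesgue_measure.-integrable `[0, 1] (EFin \o N).
Proof.
apply: continuous_compact_integrable; first exact: segment_compact.
apply: continuous_in_subspaceT => t; rewrite inE /= in_itv /=; exact: Ncont.
Qed.

Let arc_length t := (\int[lebesgue_measure]_(t in `[0%R, t]) N t)%R.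

Lemma is_derive_arc_length (t : R) : 0 < t < 1 -> is_derive t 1 arc_length (N t).
Proof.
move=> /andP[t0 t1].
have Nt : {for t, continuous N} by apply: Ncont; rewrite !ltW.
have [d <-] := continuous_FTC1_closed t1 speed_integrable t0 Nt.
by rewrite derive1E; exact/derivableP.
Qed.

Lemma arc_length_continuous : {within `[0, 1], continuous arc_length}.
Proof. exact: (parameterized_integral_continuous ler01 speed_integrable). Qed.

Lemma arc_length0 : arc_length 0 = 0.
Proof. by rewrite /arc_length set_itv1 Rintegral_set1. Qed.

Lemma arc_length_le (t : R) : 0 <= t <= 1 -> 0 <= arc_length t <= arc_length 1.
Proof.
move=> /andP[t0 t1].
have mono : {in `[0, 1]%R &, {homo arc_length : x y / x <= y}}.
  apply: ger0_derive1_le_cc => [x|x|]; last exact: arc_length_continuous.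
  - by rewrite in_itv /= => x01; have [] := is_derive_arc_length x01.
  - by rewrite in_itv /= => x01; have [_] := is_derive_arc_length x01; rewrite derive1E => ->.
by rewrite -{1}arc_length0 !mono // in_itv /= ?lexx ?ler01 ?t0 ?t1.
Qed.

Hypothesis K0 : 0 <= K.
Hypothesis df : forall t : R, 0 <= t <= 1 -> differentiable f (c t).
Hypothesis fK : forall t : R, 0 <= t <= 1 -> `|'d f (c t) (derive1 c t)| <= K * N t.

Let dfc (t : R) : 0 <= t <= 1 -> is_derive t 1 (f \o c) ('d f (c t) (derive1 c t)).
Proof.
move=> t01; have dc : differentiable c t by apply/derivable1_diffP; exact: cC1.1.
have dfc : differentiable (f \o c) t by apply: differentiable_comp => //; exact: df.
split; first exact/derivable1_diffP.
have E : 'd (f \o c) t = 'd f (c t) \o 'd c t :> (_ -> _) by apply: diff_comp => //; exact: df.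
by rewrite deriveE // E /= derive1E'.
Qed.

(** For e = 1 and e = - 1 the function e f (c t) - K L(t), with L(t) the integral of the
    speed over [0, t], has non-positive derivative. *)
Lemma curve_growth (t : R) : 0 <= t <= 1 -> `|f (c t) - f (c 0)| <= K * arc_length 1.
Proof.
move=> /andP[t0 t1].
suff half (e : R) : `|e| = 1 -> e * (f (c t) - f (c 0)) <= K * arc_length 1.
  have := half 1; have := half (- 1); rewrite normrN normr1 mul1r mulN1r => /(_ erefl) h1 /(_ erefl) h2.
  by rewrite ler_norml h2 andbT lerNl.
move=> e1.
pose G t := e * f (c t) - K * arc_length t.
have contG : {within `[0, 1], continuous G}.
  have cf : {within `[0, 1], continuous (fun t => e * f (c t))}.
    apply: continuous_in_subspaceT => x; rewrite inE /= in_itv /= => x01.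
    have dx : derivable (f \o c) x 1 by have [] := dfc x01.
    apply: cvgM; first exact: cvg_cst.
    exact: (differentiable_continuous ((derivable1_diffP _ _).1 dx)).
  by move=> x; apply: cvgB; [exact: cf|apply: cvgM; [exact: cvg_cst|exact: arc_length_continuous]].
have dG (x : R) : 0 < x < 1 -> is_derive x 1 G (e * 'd f (c x) (derive1 c x) - K * N x).
  move=> x01; have x01' : 0 <= x <= 1 by case/andP: x01 => *; rewrite !ltW.
  have h1 := is_deriveZ e (dfc x01'); have h2 := is_deriveZ K (is_derive_arc_length x01).
  exact: (is_deriveB h1 h2).
have decr : {in `[0, 1]%R &, {homo G : x y /~ x <= y}}.
  apply: ler0_derive1_le_cc => [x|x|//].
  - by rewrite in_itv /= => x01; have [] := dG x x01.
  - rewrite in_itv /= => x01; have [_ E] := dG x x01; rewrite derive1E.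
    apply: (@le_trans _ _ (e * 'd f (c x) (derive1 c x) - K * N x)); first by rewrite -E.
    have x01' : 0 <= x <= 1 by case/andP: x01 => *; rewrite !ltW.
    by rewrite subr_le0; apply: le_trans (fK x01'); rewrite -[leRHS]mul1r -e1 -normrM ler_norm.
have := decr t 0; rewrite !in_itv /= lexx ler01 t0 t1 => /(_ isT isT isT).
rewrite /G arc_length0 mulr0 subr0 => h.
have /andP[_ Lt] : 0 <= arc_length t <= arc_length 1 by apply: arc_length_le; rewrite t0.
have := ler_wpM2l K0 Lt; rewrite mulrBr; lra.
Qed.
End CurveEstimate.

(** * Completeness *)

(** The real or the imaginary part of the squared norm of a tangent vector, as in
    [pairing_potential], bounds its components in the diagonal frame.  The factors 2
    and 1 - y replace square roots. *)
Lemma energy_control (R : realType) (x y a b n : R) : y < 0 -> 0 <= n ->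
  (a - x / y * b) ^+ 2 / (- (2 * y)) + b ^+ 2 / (2 * y ^+ 2) <= n ^+ 2 ->
  `|b| <= 2 * - y * n /\ `|a - x / y * b| <= (1 - y) * n.
Proof.
move=> y0 n0; set th := a - x / y * b => h.
have s0 : 0 < - y by rewrite oppr_gt0.
have A0 : 0 <= th ^+ 2 / (- (2 * y)) by rewrite divr_ge0 ?sqr_ge0 // -mulrN mulr_ge0 // ltW.
have B0 : 0 <= b ^+ 2 / (2 * y ^+ 2) by rewrite divr_ge0 ?sqr_ge0 // mulr_ge0 ?sqr_ge0.
have bn : b ^+ 2 / (2 * y ^+ 2) <= n ^+ 2 by lra.
have an : th ^+ 2 / (- (2 * y)) <= n ^+ 2 by lra.
have y2 : 0 < y ^+ 2 by rewrite exprn_even_gt0 //= lt_eqF.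
have y22 : 0 < 2 * y ^+ 2 by rewrite pmulr_rgt0.
rewrite ler_pdivrMr // in bn.
rewrite ler_pdivrMr in an; last by rewrite -mulrN mulr_gt0.
have q1 : 0 <= 2 * - y * n by rewrite !mulr_ge0 // ltW.
have q2 : 0 <= (1 - y) * n by rewrite mulr_ge0 // addr_ge0 // ltW.
split; rewrite -ler_sqr ?nnegrE // real_normK ?num_real //.
- apply: le_trans bn _.
  by have := mulr_ge0 (sqr_ge0 n) (ltW y2); nra.
- apply: le_trans an _.
  by have := mulr_ge0 (sqr_ge0 n) (sqr_ge0 (1 + y)); nra.
Qed.

(** The left-hand side is the differential of - y - 1 / y + (x / y)^2.  Its second
    part is at most 2 (- y - 1 / y) n by [energy_control]; its first part is estimated
    by the inequality between the means of (x / y)^2 and - 1 / y. *)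
Lemma exhaustion_derivative_bound (R : realType) (x y a b n : R) : y < 0 -> 0 <= n ->
  (a - x / y * b) ^+ 2 / (- (2 * y)) + b ^+ 2 / (2 * y ^+ 2) <= n ^+ 2 ->
  `|2 * x / y ^+ 2 * (a - x / y * b) + (y ^- 2 - 1) * b| <=
    4 * (- y + - y^-1 + (x / y) ^+ 2) * n.
Proof.
move=> y0 n0 h; have [hb _] := energy_control y0 n0 h.
move: h; set th := a - x / y * b => h.
have s0 : 0 < - y by rewrite oppr_gt0.
have yn0 : y != 0 by rewrite lt_eqF.
have i0 : 0 < - y^-1 by rewrite oppr_gt0 invr_lt0.
have y2 : 0 < y ^+ 2 by rewrite exprn_even_gt0 //= lt_eqF.
have B0 : 0 <= b ^+ 2 / (2 * y ^+ 2) by rewrite divr_ge0 ?sqr_ge0 // mulr_ge0 ?sqr_ge0.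
have an : th ^+ 2 / (- (2 * y)) <= n ^+ 2 by lra.
have c1 : `|(y ^- 2 - 1) * b| <= 2 * (- y + - y^-1) * n.
  rewrite normrM.
  have : `|y ^- 2 - 1| <= y ^- 2 + 1.
    have p2 : 0 < y ^- 2 by rewrite invr_gt0.
    by rewrite ler_norml; lra.
  move=> h1; apply: le_trans (ler_pM (normr_ge0 _) (normr_ge0 _) h1 hb) _.
  rewrite le_eqVlt; apply/orP; left; apply/eqP; field; exact: yn0.
have c2 : `|2 * x / y ^+ 2 * th| <= 2 * ((x / y) ^+ 2 + - y^-1) * n.
  rewrite -ler_sqr ?nnegrE // ?mulr_ge0 ?addr_ge0 ?sqr_ge0 // ?(ltW i0) //.
  rewrite real_normK ?num_real //.
  have -> : (2 * x / y ^+ 2 * th) ^+ 2 = 8 * (x / y) ^+ 2 * - y^-1 * (th ^+ 2 / (- (2 * y))) by field.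
  have k0 : 0 <= 8 * (x / y) ^+ 2 * - y^-1 by apply: mulr_ge0 (ltW i0); apply: mulr_ge0 (sqr_ge0 _).
  apply: le_trans (ler_wpM2l k0 an) _.
  move: (x / y) (- y^-1) i0 {k0} => m i i0.
  have := mulr_ge0 (sqr_ge0 n) (sqr_ge0 (m ^+ 2 - i)).
  have := mulr_ge0 (sqr_ge0 n) (sqr_ge0 (m ^+ 2)).
  have := mulr_ge0 (sqr_ge0 n) (sqr_ge0 i).
  nra.
apply: le_trans (ler_normD _ _) _.
apply: le_trans (lerD c2 c1) _.
rewrite -mulrDl ler_wpM2r //.
by have := sqr_ge0 (x / y); lra.
Qed.

Section Completeness.
Variable R : realType.
Local Notation M := (tangent_bundle (half_plane R)).
Local Notation g := (sasaki (potential R)).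
Local Notation re k q := (lsubmx q 0 k).
Local Notation im k q := (rsubmx q 0 k).

(** The squared norm of [v] at [q]. *)
Definition energy (q v : 'rV[R]_(2 + 2)) : R :=
  (re 0 v - re 0 q / re 1 q * re 1 v) ^+ 2 / (- (2 * re 1 q)) + re 1 v ^+ 2 / (2 * re 1 q ^+ 2)
  + ((im 0 v - re 0 q / re 1 q * im 1 v) ^+ 2 / (- (2 * re 1 q)) + im 1 v ^+ 2 / (2 * re 1 q ^+ 2)).

Lemma energyE q v : M q -> pairing (g q) v v = energy q v.
Proof.
move=> Mq; rewrite pairing_potential // /energy -!expr2 invrN.
by ring.
Qed.

Let half_energy_ge0 (y a b : R) : y < 0 -> 0 <= a ^+ 2 / (- (2 * y)) + b ^+ 2 / (2 * y ^+ 2).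
Proof.
move=> y0; apply: addr_ge0; apply: divr_ge0; rewrite ?sqr_ge0 //.
  by rewrite -mulrN pmulr_rge0 // oppr_ge0 ltW.
by rewrite pmulr_rge0 // sqr_ge0.
Qed.

Lemma energy_ge0 q v : M q -> 0 <= energy q v.
Proof. by move=> Mq; rewrite addr_ge0 // half_energy_ge0. Qed.

Let norm_sq q v : M q -> Num.sqrt (energy q v) ^+ 2 = energy q v.
Proof. by move=> Mq; rewrite sqr_sqrtr // energy_ge0. Qed.

Let re_energy q v : M q ->
  (re 0 v - re 0 q / re 1 q * re 1 v) ^+ 2 / (- (2 * re 1 q)) + re 1 v ^+ 2 / (2 * re 1 q ^+ 2)
  <= Num.sqrt (energy q v) ^+ 2.
Proof. by move=> Mq; rewrite norm_sq // /energy lerDl half_energy_ge0. Qed.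

Let im_energy q v : M q ->
  (im 0 v - re 0 q / re 1 q * im 1 v) ^+ 2 / (- (2 * re 1 q)) + im 1 v ^+ 2 / (2 * re 1 q ^+ 2)
  <= Num.sqrt (energy q v) ^+ 2.
Proof. by move=> Mq; rewrite norm_sq // /energy lerDr half_energy_ge0. Qed.

(** Proper on the half-plane: a bound B confines - y to [[1 / B, B]] and (x / y)^2 to
    [[0, B]]. *)
Definition exhaustion (u : 'rV[R]_2) : R :=
  - u 0 1 + monomial (- 1) 0 1 u + monomial 1 2 2 u.

Lemma exhaustionE u : exhaustion u = - u 0 1 + - (u 0 1)^-1 + (u 0 0 / u 0 1) ^+ 2.
Proof. by rewrite /exhaustion /monomial expr1 expr0 mulr1 mulN1r mul1r expr_div_n. Qed.

Lemma exhaustion_gt0 u : half_plane R u -> 0 < exhaustion u.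
Proof.
move=> Hu; have y0 : u 0 1 < 0 := Hu.
have i0 : 0 < - (u 0 1)^-1 by rewrite oppr_gt0 invr_lt0.
rewrite exhaustionE; have := sqr_ge0 (u 0 0 / u 0 1); lra.
Qed.

Lemma is_diff_log_exhaustion q : M q -> is_diff q (fun q => ln (exhaustion (lsubmx q)))
  (fun w => (exhaustion (lsubmx q))^-1 * (2 * re 0 q / re 1 q ^+ 2 * (re 0 w - re 0 q / re 1 q * re 1 w)
     + (re 1 q ^- 2 - 1) * re 1 w)).
Proof.
move=> Mq; have y0 := half_plane_neq0 Mq.
have il : is_diff q (lsubmx : 'rV[R]_(2 + 2) -> 'rV[R]_2) lsubmx.
  by split; [exact: differentiable_lsubmx | exact: (diff_lin _ (@continuous_lsubmx _ _ _ _))].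
have gr := gradientD (gradientD (gradientN (gradient_coord 1 (lsubmx q)))
  (gradient_monomial (- 1) 0 1 Mq)) (gradient_monomial 1 2 2 Mq).
have gl := gradient_comp (f := exhaustion) gr (is_derive1_ln (exhaustion_gt0 Mq)).
have h := is_diff_comp il gl; apply: is_diff_eq h _; apply/funext => w /=.
rewrite -!mulrA -mulrDr; congr (_ * _); rewrite /monomial /=.
move: (re 0 q) (re 1 q) (re 0 w) (re 1 w) y0 {Mq il gr gl} => x y a b y0.
by field.
Qed.

Lemma log_exhaustion_bound q v : M q ->
  `|'d (fun q => ln (exhaustion (lsubmx q))) q v| <= 4 * Num.sqrt (energy q v).
Proof.
move=> Mq; have i := is_diff_log_exhaustion Mq.
have -> := diff_val (is_diff_def := i).
have p0 := exhaustion_gt0 Mq.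
rewrite normrM gtr0_norm ?invr_gt0 // ler_pdivrMl //.
have := exhaustion_derivative_bound Mq (sqrtr_ge0 _) (re_energy v Mq).
rewrite -exhaustionE => h; apply: le_trans h _.
by rewrite mulrAC mulrC.
Qed.

(** Lipschitz constant of the coordinates with respect to the metric on the sublevel
    B of [exhaustion]. *)
Definition coord_constant (B : R) : R := (1 + B) + (1 + B) * (2 * B).

Lemma coord_bound (q v : 'rV[R]_(2 + 2)) (B : R) : M q -> exhaustion (lsubmx q) <= B ->
  forall j, `|v 0 j| <= coord_constant B * Num.sqrt (energy q v).
Proof.
move=> Mq; rewrite exhaustionE => gB.
have y0 : re 1 q < 0 := Mq.
have i0 : 0 < - (re 1 q)^-1 by rewrite oppr_gt0 invr_lt0.
have m0 := sqr_ge0 (re 0 q / re 1 q).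
have key a b n : 0 <= n -> (a - re 0 q / re 1 q * b) ^+ 2 / (- (2 * re 1 q)) + b ^+ 2 / (2 * re 1 q ^+ 2) <= n ^+ 2 ->
    `|a| <= coord_constant B * n /\ `|b| <= coord_constant B * n.
  move=> n0 h; have [h1 h2] := energy_control y0 n0 h.
  have mB : `|re 0 q / re 1 q| <= 1 + B.
    rewrite -ler_sqr ?nnegrE //; last by lra.
    by rewrite real_normK ?num_real //; nra.
  have ab : `|a| <= `|a - re 0 q / re 1 q * b| + `|re 0 q / re 1 q| * `|b|.
    by rewrite -normrM -{1}[a](subrK (re 0 q / re 1 q * b)) ler_normD.
  have sB : - re 1 q <= B by lra.
  have B0 : 0 <= B by lra.
  have h1' : `|b| <= 2 * B * n by apply: le_trans h1 _; rewrite ler_wpM2r // ler_wpM2l.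
  have h2' : `|a - re 0 q / re 1 q * b| <= (1 + B) * n by apply: le_trans h2 _; rewrite ler_wpM2r //; lra.
  have mb := ler_pM (normr_ge0 _) (normr_ge0 _) mB h1'.
  rewrite /coord_constant; split.
    by apply: le_trans ab (le_trans (lerD h2' mb) _); rewrite [leRHS]mulrDl !mulrA.
  apply: le_trans h1' _; rewrite ler_wpM2r //.
  by nra.
have [r0 r1] := key _ _ _ (sqrtr_ge0 _) (re_energy v Mq).
have [k0 k1] := key _ _ _ (sqrtr_ge0 _) (im_energy v Mq).
move=> j; have -> : v 0 j = row_mx (lsubmx v) (rsubmx v) 0 j by rewrite hsubmxK.
by rewrite mxE; case: splitP => k _; move: k; apply: ord2_ind.
Qed.

End Completeness.

Section Complete.
Variable R : realType.
Local Notation M := (tangent_bundle (half_plane R)).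
Local Notation g := (sasaki (potential R)).
Local Notation re k q := (lsubmx q 0 k).
Local Notation im k q := (rsubmx q 0 k).

Definition speed (c : R -> 'rV[R]_(2 + 2)) (t : R) : R :=
  Num.sqrt (pairing (g (c t)) (derive1 c t) (derive1 c t)).

Lemma C1_curve_continuous (c : R -> 'rV[R]_(2 + 2)) : C1_curve c -> continuous c.
Proof.
by move=> [dc _] t; apply: differentiable_continuous; apply/derivable1_diffP; exact: dc.
Qed.

Lemma speed_continuous c t : C1_curve c -> M (c t) -> {for t, continuous (speed c)}.
Proof.
move=> cC1 Mt; have cc := C1_curve_continuous cC1; have dcc := cC1.2.
have y0 := half_plane_neq0 Mt.
have near_M : \forall u \near t, M (c u).
  by apply: cc; exact: open_nbhs_nbhs (conj (@open_tangent_bundle R) Mt).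
have crd (f : R -> 'rV[R]_(2 + 2)) k : {for t, continuous f} ->
    (re k (f u) @[u --> t] --> re k (f t)) /\ (im k (f u) @[u --> t] --> im k (f t)).
  move=> cf; split.
  - apply: (@continuous_comp _ _ _ f (fun q : 'rV[R]_(2 + 2) => re k q) t cf).
    apply: differentiable_continuous.
    exact: (ex_diff (is_diff_def := is_diff_re k (f t))).
  - apply: (@continuous_comp _ _ _ f (fun q : 'rV[R]_(2 + 2) => im k q) t cf).
    apply: differentiable_continuous.
    exact: (ex_diff (is_diff_def := is_diff_im k (f t))).
have [x _] := crd c 0 (cc t); have [y _] := crd c 1 (cc t).
have [r0 i0] := crd (derive1 c) 0 (dcc t); have [r1 i1] := crd (derive1 c) 1 (dcc t).
have cE : energy (c u) (derive1 c u) @[u --> t] --> energy (c t) (derive1 c t).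
  pose cont (f : R -> R) := f u @[u --> t] --> f t.
  have mulc f h : cont f -> cont h -> cont (fun u => f u * h u) by move=> cf ch; exact: cvgM.
  have addc f h : cont f -> cont h -> cont (fun u => f u + h u) by move=> cf ch; exact: cvgD.
  have oppc f : cont f -> cont (fun u => - f u) by move=> cf; exact: cvgN.
  have invc f : f t != 0 -> cont f -> cont (fun u => (f u)^-1) by move=> f0 cf; exact: cvgV.
  have two : cont (fun=> 2) by exact: cvg_cst.
  have y2 := mulc _ _ two y; have yy := mulc _ _ two (mulc _ _ y y).
  have i2 : cont (fun u => (- (2 * re 1 (c u)))^-1).
    by apply: invc (oppc _ y2); rewrite oppr_eq0 mulf_neq0.
  have ii : cont (fun u => (2 * (re 1 (c u) * re 1 (c u)))^-1).
    by apply: invc yy; rewrite !mulf_neq0.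
  have m := mulc _ _ x (invc _ y0 y).
  have tr := addc _ _ r0 (oppc _ (mulc _ _ m r1)).
  have ti := addc _ _ i0 (oppc _ (mulc _ _ m i1)).
  exact: (addc _ _ (addc _ _ (mulc _ _ (mulc _ _ tr tr) i2) (mulc _ _ (mulc _ _ r1 r1) ii))
     (addc _ _ (mulc _ _ (mulc _ _ ti ti) i2) (mulc _ _ (mulc _ _ i1 i1) ii))).
have : Num.sqrt (energy (c u) (derive1 c u)) @[u --> t] --> Num.sqrt (energy (c t) (derive1 c t)).
  exact: (continuous_comp cE (@sqrt_continuous R _)).
have E u : M (c u) -> speed c u = Num.sqrt (energy (c u) (derive1 c u)).
  by move=> Mu; rewrite /speed energyE.
rewrite /prop_for /continuous_at E //; apply: cvg_trans; apply: near_eq_cvg.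
by apply: filterS near_M => u Mu /=; rewrite E.
Qed.

(** The logarithm of the exhaustion varies by at most 4 l along the curve, so the
    whole curve stays in a sublevel where [coord_bound] applies. *)
Lemma curve_bounds c : C1_curve c -> (forall t, 0 <= t <= 1 -> M (c t)) ->
  exists l : R, [/\ 0 <= l, curve_length g c = l%:E,
    `|ln (exhaustion (lsubmx (c 1))) - ln (exhaustion (lsubmx (c 0)))| <= 4 * l &
    forall b, ln (exhaustion (lsubmx (c 0))) + 4 * l <= b ->
      forall j, `|c 1 0 j - c 0 0 j| <= coord_constant (expR b) * l].
Proof.
move=> cC1 cM.
have Nc t : 0 <= t <= 1 -> {for t, continuous (speed c)}.
  by move=> t01; apply: speed_continuous => //; exact: cM.
have N0 t : 0 <= speed c t by exact: sqrtr_ge0.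
have NE t : 0 <= t <= 1 -> speed c t = Num.sqrt (energy (c t) (derive1 c t)).
  by move=> t01; rewrite /speed energyE //; exact: cM.
pose l := (\int[lebesgue_measure]_(t in `[0%R, 1%R]) speed c t)%R.
have in01 : (0 <= 1 :> R) && (1 <= 1 :> R) by rewrite ler01 lexx.
have l0 : 0 <= l by have /andP[] := arc_length_le Nc N0 in01.
have exhaustion_l t : 0 <= t <= 1 -> `|ln (exhaustion (lsubmx (c t))) - ln (exhaustion (lsubmx (c 0)))| <= 4 * l.
  move=> t01; apply: (curve_growth (f := fun q => ln (exhaustion (lsubmx q))) cC1 Nc N0) => // u u01.
    exact: (ex_diff (is_diff_def := is_diff_log_exhaustion (cM _ u01))).
  by rewrite NE //; apply: log_exhaustion_bound; exact: cM.
exists l; split => //.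
- rewrite /curve_length -/(speed c) /l /Rintegral fineK //.
  by apply: integrable_fin_num => //; exact: (speed_integrable Nc).
- exact: exhaustion_l.
move=> b gb j.
have B0 : 0 <= expR b by exact: expR_ge0.
have K0 : 0 <= coord_constant (expR b).
  by rewrite /coord_constant !(addr_ge0, mulr_ge0).
apply: (curve_growth (f := fun q : 'rV[R]_(2 + 2) => q 0 j) cC1 Nc N0) => // u u01.
  exact: differentiable_coord.
have i : is_diff (c u) (fun q : 'rV[R]_(2 + 2) => q 0 j) (fun q => q 0 j).
  by apply: diff_coord; [move=> a v w; rewrite !mxE | exact: coord_continuous].
have -> := diff_val (is_diff_def := i).
rewrite NE //; apply: coord_bound; first exact: cM.
have p0 : 0 < exhaustion (lsubmx (c u)) by apply: exhaustion_gt0; exact: cM.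
rewrite -[leLHS]lnK ?posrE // ler_expR; apply: le_trans gb.
by have := exhaustion_l u u01; rewrite ler_norml; lra.
Qed.

Lemma pw_curve_bounds p q L : pw_curve M g p q L ->
  exists l : R, [/\ 0 <= l, L = l%:E,
    `|ln (exhaustion (lsubmx q)) - ln (exhaustion (lsubmx p))| <= 4 * l &
    forall b, ln (exhaustion (lsubmx p)) + 4 * l <= b ->
      forall j, `|q 0 j - p 0 j| <= coord_constant (expR b) * l].
Proof.
elim=> [{}p Mp|c {}q {}L cC1 cM _ [l [l0 LE gl cl]]].
  by exists 0; split => //; [rewrite subrr normr0 mulr0|move=> b _ j; rewrite subrr normr0 mulr0].
have [l1 [l10 L1E gl1 cl1]] := curve_bounds cC1 cM.
exists (l1 + l); split; first by rewrite addr_ge0.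
- by rewrite L1E LE.
- by move: gl gl1; rewrite !ler_norml; lra.
move=> b gb j; have h1 : `|c 1 0 j - c 0 0 j| <= coord_constant (expR b) * l1 by apply: cl1; lra.
have h2 : `|q 0 j - c 1 0 j| <= coord_constant (expR b) * l.
  by apply: cl; move: gl1; rewrite ler_norml; lra.
have -> : q 0 j - c 0 0 j = (c 1 0 j - c 0 0 j) + (q 0 j - c 1 0 j) by ring.
by rewrite mulrDr; apply: le_trans (ler_normD _ _) (lerD h1 h2).
Qed.

Lemma riem_dist_ge0 p q : (0 <= riem_dist M g p q)%E.
Proof.
by apply: le_ereal_inf_tmp => L /pw_curve_bounds[l [l0 -> _ _]]; rewrite lee_fin.
Qed.

(** Near a point the metric is dominated by a multiple of the Euclidean one, since y
    stays away from 0 and x is bounded. *)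
Lemma segment_bound l : M l -> exists2 r : R, 0 < r &
  exists2 K : R, 0 <= K & forall q, `|q - l| < r -> M q /\ forall v, energy q v <= (K * `|v|) ^+ 2.
Proof.
move=> Ml; have y0 : re 1 l < 0 := Ml.
pose s := - re 1 l / 2; have s0 : 0 < s by rewrite divr_gt0 // oppr_gt0.
pose X := `|re 0 l| + s.
have X0 : 0 <= X by rewrite addr_ge0 // ltW.
pose k := (1 + X / s) ^+ 2 / (2 * s) + (2 * s ^+ 2)^-1.
have s2 : 0 < 2 * s by rewrite mulr_gt0.
have ss : 0 < 2 * s ^+ 2 by rewrite pmulr_rgt0 // exprn_gt0.
have k0 : 0 <= k.
  by apply: addr_ge0; [apply: divr_ge0; [exact: sqr_ge0|exact: ltW]|rewrite invr_ge0 ltW].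
exists s => //; exists (Num.sqrt (2 * k)); first exact: sqrtr_ge0.
move=> q qr.
have cn (u : 'rV[R]_(2 + 2)) j : `|re j u| <= `|u| /\ `|im j u| <= `|u|.
  by rewrite !mxE; split; exact: coord_norm_le.
have x1 : `|re 0 q| <= X.
  have [h _] := cn (q - l) 0; rewrite !(re_add q, re_opp) in h.
  rewrite -[re 0 q](subrK (re 0 l)) addrC.
  by apply: le_trans (ler_normD _ _) _; rewrite /X lerD2l; exact: le_trans h (ltW qr).
have y1 : s <= - re 1 q.
  have [h _] := cn (q - l) 1; rewrite !(re_add q, re_opp) in h.
  have := le_lt_trans h qr; rewrite ltr_norml /s; lra.
have Mq : M q by rewrite /tangent_bundle /half_plane /=; lra.
split => // v.
rewrite exprMn sqr_sqrtr; last by rewrite mulr_ge0.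
have half a b : `|a| <= `|v| -> `|b| <= `|v| ->
    (a - re 0 q / re 1 q * b) ^+ 2 / (- (2 * re 1 q)) + b ^+ 2 / (2 * re 1 q ^+ 2) <= k * `|v| ^+ 2.
  move=> av bv.
  have iy : `|re 0 q / re 1 q| <= X / s.
    rewrite normrM normfV ler_pM ?invr_ge0 // lef_pV2 ?posrE //; last by rewrite ltr0_norm; lra.
    by rewrite ltr0_norm; lra.
  have th : `|a - re 0 q / re 1 q * b| <= (1 + X / s) * `|v|.
    apply: le_trans (ler_normB _ _) _; rewrite normrM mulrDl mul1r.
    by apply: lerD => //; apply: ler_pM.
  have th2 : (a - re 0 q / re 1 q * b) ^+ 2 <= (1 + X / s) ^+ 2 * `|v| ^+ 2.
    by rewrite -exprMn -(real_normK (num_real (_ - _))) ler_sqr // nnegrE (le_trans _ th).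
  have b2 : b ^+ 2 <= `|v| ^+ 2 by rewrite -(real_normK (num_real b)) ler_sqr ?nnegrE.
  rewrite /k [leRHS]mulrDl; apply: lerD.
    rewrite [leRHS]mulrAC; apply: ler_pM => //; first exact: sqr_ge0.
    - by rewrite invr_ge0; lra.
    - by rewrite lef_pV2 ?posrE; lra.
  rewrite [leRHS]mulrC; apply: ler_pM => //; first exact: sqr_ge0.
  - by rewrite invr_ge0 pmulr_rge0 // sqr_ge0.
  - have y2 : 0 < re 1 q ^+ 2 by rewrite -sqrrN exprn_gt0 //; lra.
    have yy : 0 < 2 * re 1 q ^+ 2 by rewrite pmulr_rgt0.
    rewrite lef_pV2 ?posrE // ler_pM2l // -[leRHS]sqrrN ler_sqr // nnegrE; lra.
have [r0 i0] := cn v 0; have [r1 i1] := cn v 1.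
have -> : 2 * k * `|v| ^+ 2 = k * `|v| ^+ 2 + k * `|v| ^+ 2 by ring.
by apply: lerD; apply: half.
Qed.

(** The straight segment is an admissible curve. *)
Lemma riem_dist_segment l : M l -> exists2 r : R, 0 < r &
  exists2 K : R, 0 <= K & forall q, `|q - l| < r -> (riem_dist M g q l <= (K * `|q - l|)%:E)%E.
Proof.
move=> Ml; have [r r0 [K K0 loc]] := segment_bound Ml.
exists r => //; exists K => // q qr.
pose c (t : R) := q + t *: (l - q).
have dc (t : R) : is_derive t 1 c (l - q).
  have il : is_diff t c ( *:%R ^~ (l - q)).
    by have := is_diffD (is_diff_cst q t) (is_diff_scalel t (l - q)); rewrite add0r.
  have dif : differentiable c t by exact: ex_diff.
  by split; [exact: diff_derivable | rewrite deriveE // diff_val scale1r].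
have dcE : derive1 c = cst (l - q).
  by apply/funext => t; rewrite derive1E; have [_ ->] := dc t.
have cC1 : C1_curve c.
  by split=> [t|]; [have [] := dc t | rewrite dcE; exact: cst_continuous].
have c0 : c 0 = q by rewrite /c scale0r addr0.
have c1 : c 1 = l by rewrite /c scale1r addrC subrK.
have near_l t : 0 <= t <= 1 -> `|c t - l| < r.
  move=> /andP[t0 t1].
  have -> : c t - l = (1 - t) *: (q - l) by apply/rowP => j; rewrite !mxE; ring.
  rewrite normrZ ger0_norm ?subr_ge0 //; apply: le_lt_trans qr.
  by rewrite ler_piMl // lerBlDr lerDl.
have cM t : 0 <= t <= 1 -> M (c t) by move=> t01; have [] := loc _ (near_l t t01).
have [len [_ lenE _ _]] := curve_bounds cC1 cM.
have pw : pw_curve M g q l (curve_length g c + 0)%E.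
  by rewrite -{1}c0; apply: pw_cons => //; rewrite c1; exact: pw_nil.
apply: ge_ereal_inf; exists (curve_length g c + 0)%E => //.
rewrite adde0 /curve_length.
have Nc t : 0 <= t <= 1 -> {for t, continuous (speed c)}.
  by move=> t01; apply: speed_continuous => //; exact: cM.
have spd t : 0 <= t <= 1 -> speed c t <= K * `|q - l|.
  move=> t01; rewrite /speed energyE ?dcE /cst /=; last exact: cM.
  have [_ h] := loc _ (near_l t t01).
  rewrite -[leRHS]ger0_norm ?mulr_ge0 // -sqrtr_sqr ler_wsqrtr // distrC.
  exact: h.
rewrite -/(speed c).
have intK : lebesgue_measure.-integrable `[0%R, 1%R] (EFin \o cst (K * `|q - l|)).
  by apply: continuous_compact_integrable; [exact: segment_compact|move=> x; exact: cvg_cst].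
have fin : (\int[lebesgue_measure]_(t in `[0%R, 1%R]) (speed c t)%:E)%E \is a fin_num.
  by apply: integrable_fin_num => //; exact: (speed_integrable Nc).
rewrite -(fineK fin) lee_fin.
have -> : K * `|q - l| = (\int[lebesgue_measure]_(t in `[0%R, 1%R]) cst (K * `|q - l|) t)%R.
  by rewrite Rintegral_cst //= lebesgue_measure_itv /= lte_fin ltr01 sube0 /= mulr1.
by apply: le_Rintegral => //; exact: (speed_integrable Nc).
Qed.

Theorem complete_potential : riem_complete M g.
Proof.
move=> x xM cauchy.
have [N1 HN1] := cauchy 1 ltr01.
pose b := ln (exhaustion (lsubmx (x N1))) + 4.
have curve i j e : 0 < e -> e <= 1 -> (riem_dist M g (x i) (x j) < e%:E)%E ->
    exists l : R, [/\ 0 <= l, l < e,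
    `|ln (exhaustion (lsubmx (x j))) - ln (exhaustion (lsubmx (x i)))| <= 4 * l &
    forall b, ln (exhaustion (lsubmx (x i))) + 4 * l <= b ->
      forall k, `|x j 0 k - x i 0 k| <= coord_constant (expR b) * l].
  move=> e0 e1 /ereal_inf_lt[L /pw_curve_bounds[l [l0 -> h1 h2]]].
  by rewrite lte_fin => le; exists l.
have xb i : (N1 <= i)%N -> ln (exhaustion (lsubmx (x i))) <= b.
  move=> Ni; have [l [l0 l1 h _]] := curve _ _ _ ltr01 (lexx 1) (HN1 _ _ (leqnn _) Ni).
  by move: h; rewrite ler_norml /b; lra.
pose K := coord_constant (expR (b + 4)).
have K0 : 0 < K by rewrite /K /coord_constant; have := expR_gt0 (b + 4); nra.
have cx : cauchy_ex (x @ \oo).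
  move=> e e0; pose e' := Num.min 1 (e / (2 * K)).
  have e'0 : 0 < e' by rewrite lt_min ltr01 divr_gt0 // mulr_gt0.
  have [N2 HN2] := cauchy e' e'0.
  exists (x (maxn N1 N2)); exists (maxn N1 N2) => // j /=; rewrite geq_max => /andP[N1j N2j].
  have e'1 : e' <= 1 by rewrite ge_min lexx.
  have [l [l0 le _ h]] := curve _ _ _ e'0 e'1 (HN2 _ _ (leq_maxr N1 N2) N2j).
  have xbm := xb _ (leq_maxl N1 N2).
  rewrite -ball_normE /= distrC; apply: (@le_lt_trans _ _ (K * l)).
    apply: row_norm_le; first by rewrite mulr_ge0 // ltW.
    by move=> k; rewrite !mxE; apply: h; lra.
  have : l <= e / (2 * K) by apply: ltW; apply: lt_le_trans le _; rewrite ge_min lexx orbT.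
  rewrite ler_pdivlMr ?mulr_gt0 // => h3.
  by rewrite mulrC; lra.
have cvgx : cvg (x @ \oo) by apply: cauchy_cvg; exact: cauchy_exP.
set l := lim (x @ \oo) in cvgx.
have xl : x @ \oo --> l by exact: cvgx.
have near_x e : 0 < e -> exists N, forall i, (N <= i)%N -> `|x i - l| < e.
  move=> e0; have /cvgrPdist_lt/(_ _ e0)[N _ HN] := xl.
  by exists N => i Ni; rewrite distrC; exact: HN.
(* The exhaustion is bounded on the sequence, so y stays below a negative
   constant. *)
have Ml : M l.
  have s0 : 0 < expR (- b) by exact: expR_gt0.
  have [N HN] := near_x _ s0.
  pose i := maxn N1 N.
  have Mi := xM i; have y0 : re 1 (x i) < 0 := Mi.
  have i0 : 0 < - (re 1 (x i))^-1 by rewrite oppr_gt0 invr_lt0.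
  have gi : exhaustion (lsubmx (x i)) <= expR b.
    have p0 := exhaustion_gt0 Mi.
    by rewrite -[leLHS]lnK ?posrE // ler_expR; apply: xb; exact: leq_maxl.
  have iy : - (re 1 (x i))^-1 <= expR b.
    by move: gi; rewrite exhaustionE; have := sqr_ge0 (re 0 (x i) / re 1 (x i)); lra.
  have ys : expR (- b) <= - re 1 (x i).
    by rewrite expRN -[leRHS]invrK lef_pV2 ?posrE ?expR_gt0 // invrN.
  have := HN i (leq_maxr _ _); have := coord_norm_le (x i - l) (lshift 2 1).
  rewrite /tangent_bundle /half_plane /= !mxE in ys y0 *.
  by move=> h1 h2; have := le_lt_trans h1 h2; rewrite ltr_norml; lra.
exists l => //.
have [r r0 [C C0 Cb]] := riem_dist_segment Ml.
apply: (@squeeze_cvge _ _ _ _ (cst 0%E) _ (fun k => (C * `|x k - l|)%:E)).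
- have [N HN] := near_x _ r0; exists N => // k /= Nk.
  by rewrite riem_dist_ge0 /=; apply: Cb; exact: HN.
- exact: cvg_cst.
- apply: cvg_EFin; first by near=> k.
  rewrite -[X in _ --> X](mulr0 C); apply: cvgM; first exact: cvg_cst.
  have -> : (0 : R) = `|l - l| by rewrite subrr normr0.
  by apply: cvg_norm; apply: cvgB => //; exact: cvg_cst.
Unshelve. all: by end_near. Qed.
End Complete.

Theorem mainTheorem3 (R : realType) :
  [/\ riem_complete (tangent_bundle (half_plane R)) (sasaki (potential R)),
      NOAB (half_plane R) (potential R),
      ~ hermitian_symmetric (tangent_bundle (half_plane R))
          (sasaki (potential R)) &
      ~ biholomorphic (tangent_bundle (half_plane R))
          ([set: 'rV[R]_(2 + 2)] : set 'rV[R]_(2 + 2))].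
Proof.
split.
- exact: complete_potential.
- exact: NOAB_potential.
- exact: not_hermitian_symmetric_potential.
- exact: not_biholomorphic_plane.
Qed.
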